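(* (ZF, without the Axiom of Choice.) If $UD(\omega_1)$ holds, $\kappa\in On$ is an arbitrary cardinal, and $n\in\omega$, then every $n$-almost disjoint family $\mathcal A\subset[\kappa]^\omega$ is essentially disjoint.
   Context: The base theory is ZF. Cardinals are initial ordinals, and $[\kappa]^\omega$ is the set of countably infinite subsets of $\kappa$. A function $f$ is a uniform denumeration on $\omega_1$ iff $\mathrm{dom}(f)=\omega_1$ and $f(\alpha)$ is a function from $\omega$ onto $\alpha$ for each $1\le\alpha<\omega_1$. $UD(\omega_1)$ is the assertion that there exists a uniform denumeration on $\omega_1$. A family $\mathcal A$ is $n$-almost disjoint iff $|A\cap B|<n$ for each $\{A,B\}\in[\mathcal A]^2$. A family $\mathcal A$ is essentially disjoint iff there is a function $f$ with $\mathrm{dom}(f)=\mathcal A$ and $f(A)\in[A]^{<\omega}$ for each $A\in\mathcal A$ such that $\{A\setminus f(A):A\in\mathcal A\}$ is a family of pairwise disjoint sets. *)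

(* Defs.v *)
(** Plain Rocq: no library beyond the prelude is used.

    A theorem of ZF is rendered as a statement about an arbitrary structure
    [(M, ∈)] satisfying the axioms of first-order ZF.  Separation and
    Replacement range over deeply embedded first-order formulas (with
    parameters), not over arbitrary predicates [M -> Prop]: with predicates, a
    choice principle of the metatheory would give the Axiom of Choice in [M].
    All set-theoretic notions (ordered pairs, functions, [ω], finiteness,
    countability, cardinals, ...) are those of [M], i.e. they only quantify over
    elements of [M]. *)

Set Implicit Arguments.
Unset Strict Implicit.

Record set_structure := SetStructure {
  carrier :> Type;
  mem : carrier -> carrier -> Prop
}.

Arguments mem {_} _ _.

Notation "x ∈ y" := (mem x y) (at level 70, no associativity).
Notation "x ∉ y" := (~ mem x y) (at level 70, no associativity).

(** First-order formulas of the language [{∈, =}], with de Bruijn variables. *)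
Inductive formula : Type :=
  | FMem (i j : nat)
  | FEq (i j : nat)
  | FFalse
  | FAnd (p q : formula)
  | FOr (p q : formula)
  | FImp (p q : formula)
  | FAll (p : formula)
  | FEx (p : formula).

Definition env_cons (T : Type) (x : T) (e : nat -> T) : nat -> T :=
  fun i => match i with O => x | S j => e j end.

Fixpoint sat (M : set_structure) (e : nat -> M) (p : formula) : Prop :=
  match p with
  | FMem i j => e i ∈ e j
  | FEq i j => e i = e j
  | FFalse => False
  | FAnd p q => sat e p /\ sat e q
  | FOr p q => sat e p \/ sat e q
  | FImp p q => sat e p -> sat e q
  | FAll p => forall x : M, sat (env_cons x e) p
  | FEx p => exists x : M, sat (env_cons x e) p
  end.

Definition subset (M : set_structure) (x y : M) : Prop :=
  forall z, z ∈ x -> z ∈ y.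

Notation "x ⊆ y" := (subset x y) (at level 70, no associativity).

Definition is_empty (M : set_structure) (x : M) : Prop := forall z, z ∉ x.

(** [s = x ∪ {x}] *)
Definition is_succ (M : set_structure) (s x : M) : Prop :=
  forall z, z ∈ s <-> z ∈ x \/ z = x.

Definition inductive_set (M : set_structure) (x : M) : Prop :=
  (exists e, is_empty e /\ e ∈ x) /\
  (forall y, y ∈ x -> exists s, is_succ s y /\ s ∈ x).

Record ZF (M : set_structure) : Prop := {
  ZF_extensionality :
    forall x y : M, (forall z, z ∈ x <-> z ∈ y) -> x = y;
  ZF_foundation :
    forall x : M, (exists y, y ∈ x) ->
      exists y, y ∈ x /\ forall z, z ∈ x -> z ∉ y;
  ZF_pairing :
    forall x y : M, exists p, forall z, z ∈ p <-> z = x \/ z = y;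
  ZF_union :
    forall x : M, exists u, forall z, z ∈ u <-> exists y, y ∈ x /\ z ∈ y;
  ZF_powerset :
    forall x : M, exists p, forall z, z ∈ p <-> z ⊆ x;
  ZF_infinity :
    exists x : M, inductive_set x;
  ZF_separation :
    forall (p : formula) (e : nat -> M) (a : M),
      exists b, forall x, x ∈ b <-> x ∈ a /\ sat (env_cons x e) p;
  ZF_replacement :
    forall (p : formula) (e : nat -> M) (a : M),
      (forall x y y', x ∈ a ->
         sat (env_cons x (env_cons y e)) p ->
         sat (env_cons x (env_cons y' e)) p -> y = y') ->
      exists b, forall y, y ∈ b <->
        exists x, x ∈ a /\ sat (env_cons x (env_cons y e)) p
}.

(** Functions are sets of Kuratowski pairs [(x, y) = {{x}, {x, y}}]. *)

Definition is_upair (M : set_structure) (p x y : M) : Prop :=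
  forall z, z ∈ p <-> z = x \/ z = y.

Definition is_pair (M : set_structure) (p x y : M) : Prop :=
  forall z, z ∈ p <-> is_upair z x x \/ is_upair z x y.

(** [(x, y) ∈ f]; for a function [f] this is [f(x) = y]. *)
Definition maps_to (M : set_structure) (f x y : M) : Prop :=
  exists p, is_pair p x y /\ p ∈ f.

Definition is_function (M : set_structure) (f : M) : Prop :=
  (forall p, p ∈ f -> exists x y, is_pair p x y) /\
  (forall x y y', maps_to f x y -> maps_to f x y' -> y = y').

Definition is_dom (M : set_structure) (f X : M) : Prop :=
  forall x, x ∈ X <-> exists y, maps_to f x y.

Definition is_function_onto (M : set_structure) (f X Y : M) : Prop :=
  is_function f /\ is_dom f X /\
  (forall y, y ∈ Y <-> exists x, maps_to f x y).

Definition is_bijection (M : set_structure) (f X Y : M) : Prop :=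
  is_function_onto f X Y /\
  (forall x x' y, maps_to f x y -> maps_to f x' y -> x = x').

Definition equinumerous (M : set_structure) (X Y : M) : Prop :=
  exists f, is_bijection f X Y.

Definition transitive_set (M : set_structure) (x : M) : Prop :=
  forall y, y ∈ x -> y ⊆ x.

Definition well_ordered_by_mem (M : set_structure) (x : M) : Prop :=
  (forall a, a ∈ x -> a ∉ a) /\
  (forall a b c, a ∈ x -> b ∈ x -> c ∈ x -> a ∈ b -> b ∈ c -> a ∈ c) /\
  (forall a b, a ∈ x -> b ∈ x -> a ∈ b \/ a = b \/ b ∈ a) /\
  (forall s, s ⊆ x -> (exists a, a ∈ s) ->
     exists a, a ∈ s /\ forall b, b ∈ s -> a = b \/ a ∈ b).

Definition is_ordinal (M : set_structure) (x : M) : Prop :=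
  transitive_set x /\ well_ordered_by_mem x.

Definition ordinal_le (M : set_structure) (a b : M) : Prop := a ∈ b \/ a = b.

Definition is_one (M : set_structure) (x : M) : Prop :=
  forall z, z ∈ x <-> is_empty z.

Definition is_cardinal (M : set_structure) (k : M) : Prop :=
  is_ordinal k /\ forall b, b ∈ k -> ~ equinumerous b k.

Definition is_omega (M : set_structure) (w : M) : Prop :=
  inductive_set w /\ forall v, inductive_set v -> w ⊆ v.

Definition is_natural (M : set_structure) (n : M) : Prop :=
  exists w, is_omega w /\ n ∈ w.

Definition is_finite (M : set_structure) (X : M) : Prop :=
  exists m, is_natural m /\ equinumerous X m.

Definition countably_infinite (M : set_structure) (X : M) : Prop :=
  exists w, is_omega w /\ equinumerous X w.

Definition countable (M : set_structure) (X : M) : Prop :=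
  is_finite X \/ countably_infinite X.

(** The least uncountable ordinal. *)
Definition is_omega1 (M : set_structure) (w1 : M) : Prop :=
  is_ordinal w1 /\ ~ countable w1 /\ (forall a, a ∈ w1 -> countable a).

Definition uniform_denumeration (M : set_structure) (f w1 : M) : Prop :=
  is_function f /\ is_dom f w1 /\
  (forall w one a, is_omega w -> is_one one -> a ∈ w1 -> ordinal_le one a ->
     exists g, maps_to f a g /\ is_function_onto g w a).

(** [UD(ω₁)] *)
Definition UD_omega1 (M : set_structure) : Prop :=
  exists w1 f : M, is_omega1 w1 /\ uniform_denumeration f w1.

(** [|X| < n], where [|X|] is the initial ordinal equinumerous with [X]. *)
Definition card_lt (M : set_structure) (X n : M) : Prop :=
  exists c, is_cardinal c /\ equinumerous X c /\ c ∈ n.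

Definition is_inter (M : set_structure) (I A B : M) : Prop :=
  forall z, z ∈ I <-> z ∈ A /\ z ∈ B.

Definition is_setminus (M : set_structure) (D A B : M) : Prop :=
  forall z, z ∈ D <-> z ∈ A /\ z ∉ B.

Definition disjoint (M : set_structure) (A B : M) : Prop :=
  forall z, ~ (z ∈ A /\ z ∈ B).

Definition n_almost_disjoint (M : set_structure) (n F : M) : Prop :=
  forall A B, A ∈ F -> B ∈ F -> A <> B ->
    exists I, is_inter I A B /\ card_lt I n.

(** [{A \ f(A) : A ∈ F}] is read as a family indexed by [F]: distinct members
    [A], [B] of [F] give disjoint sets [A \ f(A)] and [B \ f(B)]. *)
Definition essentially_disjoint (M : set_structure) (F : M) : Prop :=
  exists f, is_function f /\ is_dom f F /\
    (forall A s, A ∈ F -> maps_to f A s -> s ⊆ A /\ is_finite s) /\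
    (forall A B s t D E, A ∈ F -> B ∈ F -> A <> B ->
       maps_to f A s -> maps_to f B t ->
       is_setminus D A s -> is_setminus E B t -> disjoint D E).

(** [F ⊂ [k]^ω] *)
Definition family_of_countably_infinite_subsets (M : set_structure)
    (F k : M) : Prop :=
  forall A, A ∈ F -> A ⊆ k /\ countably_infinite A.

(* Main.v *)
(** Let [F] be the family.  Call a finite set determining when it lies in at most
    one member of [F], and let [cl(s)] be the closure of [s] under [A ∈ F] having
    a determining subset inside the set built so far.  A member not contained in
    a closed set meets it in a finite set, and [cl(s)] is countable for finite [s].

    Finite subsets of [κ] are well-ordered by [t < s] iff the largest element of
    the symmetric difference is in [s].  Let [r(A)] be the least [s] with
    [A ⊆ cl(s)].  The union of the [cl(t)], [t < s], is the union over [x ∈ s] of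
    the directed unions of the [cl(t)], [t ⊆ x ∪ {y ∈ s | x ∈ y}] finite, so it is
    a union of finitely many closed sets, and [A] meets that union for [s = r(A)]
    in a finite set.  This takes care of all [B] with [r(B) < r(A)], without any
    cardinal arithmetic and without choice.

    The [B] with [r(B) = r(A)] are countably many, and must be enumerated uniformly
    in [r(A)].  A countable set of ordinals is isomorphic to an ordinal below
    [ω₁], hence is enumerated through the uniform denumeration; this applies to
    [cl(r(A))], and transfers to its determining finite subsets. *)

From Stdlib Require Import ClassicalEpsilon FunctionalExtensionality Arith.
Require Import Defs.

Set Implicit Arguments.
Unset Strict Implicit.

(** * Renaming of variables and definability with parameters *)

Fixpoint rename (r : nat -> nat) (p : formula) : formula :=
  match p with
  | FMem i j => FMem (r i) (r j)
  | FEq i j => FEq (r i) (r j)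
  | FFalse => FFalse
  | FAnd p q => FAnd (rename r p) (rename r q)
  | FOr p q => FOr (rename r p) (rename r q)
  | FImp p q => FImp (rename r p) (rename r q)
  | FAll p => FAll (rename (env_cons 0 (fun i => S (r i))) p)
  | FEx p => FEx (rename (env_cons 0 (fun i => S (r i))) p)
  end.

Lemma sat_rename (M : set_structure) (p : formula) :
  forall (r : nat -> nat) (e : nat -> M),
    sat e (rename r p) <-> sat (fun i => e (r i)) p.
Proof.
  (* Under a binder the renaming fixes the bound variable 0 and shifts all other indices; this is
     the compatibility with extending the environment. *)
  assert (Hup : forall (r : nat -> nat) (e : nat -> M) x,
    (fun i => env_cons x e (env_cons 0 (fun i => S (r i)) i)) =
    env_cons x (fun i => e (r i))).
  { intros r e x. apply functional_extensionality. intros [|i]; reflexivity. }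
  induction p; intros r e; simpl; try tauto.
  - rewrite IHp1, IHp2. tauto.
  - rewrite IHp1, IHp2. tauto.
  - rewrite IHp1, IHp2. tauto.
  - split; intros H x; specialize (H x); rewrite IHp, Hup in *; exact H.
  - split; intros [x H]; exists x; rewrite IHp, Hup in *; exact H.
Qed.

Section ZF.
Context (M : set_structure) (HZF : ZF M).

Definition valuation (r : nat -> nat + M) (e : nat -> M) : nat -> M :=
  fun i => match r i with inl k => e k | inr c => c end.

(** Definability: [P] is expressed by a formula whose variables denote entries of
    the environment or, through [r], parameters from [M]. *)
Definition D (P : (nat -> M) -> Prop) : Prop :=
  exists p r, forall e, P e <-> sat (valuation r e) p.

(** A term counts as definable when its graph is: the value sits at index 0 and the arguments are
    shifted by one. *)
Definition T (t : (nat -> M) -> M) : Prop :=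
  D (fun e => e 0 = t (fun k => e (S k))).

(** Each predicate brings its own assignment of parameters. The two are interleaved, even indices
    for [P] and odd ones for [Q], so that a connective can join the formulas under one
    assignment. *)
Lemma D_common (P Q : (nat -> M) -> Prop) : D P -> D Q ->
  exists p q r, (forall e, P e <-> sat (valuation r e) p) /\
                (forall e, Q e <-> sat (valuation r e) q).
Proof.
  intros [p [r Hp]] [q [r' Hq]].
  exists (rename (fun i => 2 * i) p), (rename (fun i => 2 * i + 1) q),
    (fun i => if Nat.even i then r (Nat.div2 i) else r' (Nat.div2 i)).
  assert (Hj : forall e : nat -> M, valuation r e =
    (fun i => valuation (fun i => if Nat.even i then r (Nat.div2 i)
       else r' (Nat.div2 i)) e (2 * i))).
  { intros e. apply functional_extensionality. intros i. unfold valuation.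
    rewrite Nat.even_even, Nat.div2_double. reflexivity. }
  assert (Hj' : forall e : nat -> M, valuation r' e =
    (fun i => valuation (fun i => if Nat.even i then r (Nat.div2 i)
       else r' (Nat.div2 i)) e (2 * i + 1))).
  { intros e. apply functional_extensionality. intros i. unfold valuation.
    rewrite Nat.even_odd, Nat.add_1_r, Nat.div2_succ_double. reflexivity. }
  split; intros e; rewrite sat_rename.
  - rewrite Hp, Hj. reflexivity.
  - rewrite Hq, Hj'. reflexivity.
Qed.

Lemma D_and P Q : D P -> D Q -> D (fun e => P e /\ Q e).
Proof.
  intros HP HQ. destruct (D_common HP HQ) as [p [q [r [Hp Hq]]]].
  exists (FAnd p q), r. intros e. simpl. rewrite Hp, Hq. tauto.
Qed.

Lemma D_or P Q : D P -> D Q -> D (fun e => P e \/ Q e).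
Proof.
  intros HP HQ. destruct (D_common HP HQ) as [p [q [r [Hp Hq]]]].
  exists (FOr p q), r. intros e. simpl. rewrite Hp, Hq. tauto.
Qed.

Lemma D_imp P Q : D P -> D Q -> D (fun e => P e -> Q e).
Proof.
  intros HP HQ. destruct (D_common HP HQ) as [p [q [r [Hp Hq]]]].
  exists (FImp p q), r. intros e. simpl. rewrite Hp, Hq. tauto.
Qed.

Lemma D_False : D (fun _ => False).
Proof. exists FFalse, (fun i => inl i). intros e. simpl. tauto. Qed.

Lemma D_not P : D P -> D (fun e => ~ P e).
Proof. intros HP. exact (D_imp HP D_False). Qed.

Lemma D_iff P Q : D P -> D Q -> D (fun e => P e <-> Q e).
Proof. intros HP HQ. exact (D_and (D_imp HP HQ) (D_imp HQ HP)). Qed.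

Lemma D_ext P Q : (forall e, P e <-> Q e) -> D P -> D Q.
Proof.
  intros H [p [r Hp]]. exists p, r. intros e. rewrite <- H. apply Hp.
Qed.

(** Prepares quantification: [r] may send any number of indices to entry 0 of the environment, so
    all of these are renamed to the bound variable and the others are shifted past it. *)
Lemma D_binder (P : (nat -> M) -> M -> Prop) :
  D (fun e => P (fun k => e (S k)) (e 0)) ->
  exists p r, forall e x, P e x <-> sat (env_cons x (valuation r e)) p.
Proof.
  intros [p [r Hp]].
  exists (rename (fun i => match r i with inl 0 => 0 | _ => S i end) p).
  exists (fun i => match r i with inl (S k) => inl k | s => s end).
  intros e x. rewrite sat_rename. rewrite (Hp (env_cons x e)).
  replace (valuation r (env_cons x e)) with
    (fun i => env_cons x
       (valuation (fun i => match r i with inl (S k) => inl k | s => s end) e)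
       (match r i with inl 0 => 0 | _ => S i end)); [reflexivity|].
  apply functional_extensionality. intros i. unfold valuation.
  destruct (r i) as [[|k]|c] eqn:E; simpl; try rewrite E; reflexivity.
Qed.

Lemma D_ex (P : (nat -> M) -> M -> Prop) :
  D (fun e => P (fun k => e (S k)) (e 0)) -> D (fun e => exists x, P e x).
Proof.
  intros H. destruct (D_binder H) as [p [r Hp]]. exists (FEx p), r.
  intros e. simpl. split; intros [x Hx]; exists x; apply Hp; exact Hx.
Qed.

Lemma D_all (P : (nat -> M) -> M -> Prop) :
  D (fun e => P (fun k => e (S k)) (e 0)) -> D (fun e => forall x, P e x).
Proof.
  intros H. destruct (D_binder H) as [p [r Hp]]. exists (FAll p), r.
  intros e. simpl. split; intros Hx x; apply Hp, Hx.
Qed.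

Lemma D_ren (r : nat -> nat) (P : (nat -> M) -> Prop) :
  D P -> D (fun e => P (fun k => e (r k))).
Proof.
  intros [p [s Hp]]. exists p.
  exists (fun i => match s i with inl k => inl (r k) | inr c => inr c end).
  intros e. rewrite Hp.
  replace (valuation s (fun k => e (r k))) with
   (valuation (fun i => match s i with inl k => inl (r k) | inr c => inr c end) e);
   [reflexivity|].
  apply functional_extensionality. intros i. unfold valuation.
  destruct (s i); reflexivity.
Qed.

Lemma T_ren (r : nat -> nat) (t : (nat -> M) -> M) :
  T t -> T (fun e => t (fun k => e (r k))).
Proof.
  intros H. exact (D_ren (fun i => match i with 0 => 0 | S k => S (r k) end) H).
Qed.

Lemma D_eq_var i j : D (fun e => e i = e j).
Proof.
  exists (FEq i j), (fun i => inl i). intros e. simpl. reflexivity.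
Qed.

Lemma D_mem_var i j : D (fun e => e i ∈ e j).
Proof.
  exists (FMem i j), (fun i => inl i). intros e. simpl. reflexivity.
Qed.

Lemma T_var i : T (fun e => e i).
Proof. exact (D_eq_var 0 (S i)). Qed.

Lemma T_const c : T (fun _ => c).
Proof.
  exists (FEq 0 1), (fun i => match i with 0 => inl 0 | _ => inr c end).
  intros e. simpl. reflexivity.
Qed.

(** Substituting a term amounts to an existential quantifier over its value. The renaming [r]
    relocates the remaining arguments of [P]. *)
Lemma D_app (r : nat -> nat) (P : (nat -> M) -> M -> Prop) (t : (nat -> M) -> M) :
  D (fun e => P (fun k => e (S k)) (e 0)) -> T t ->
  D (fun e => P (fun k => e (r k)) (t e)).
Proof.
  intros HP Ht.
  apply D_ext with (fun e => exists x, x = t e /\ P (fun k => e (r k)) x).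
  { intros e. split; [intros [x [-> H]]; exact H | intros H; exists (t e); tauto]. }
  apply D_ex. apply D_and; [exact Ht|].
  exact (D_ren (fun i => match i with 0 => 0 | S k => S (r k) end) HP).
Qed.

Lemma T_app (r : nat -> nat) (u : (nat -> M) -> M -> M) (t : (nat -> M) -> M) :
  T (fun e => u (fun k => e (S k)) (e 0)) -> T t ->
  T (fun e => u (fun k => e (r k)) (t e)).
Proof.
  intros Hu Ht. unfold T.
  apply D_ext with (fun e => exists x, x = t (fun k => e (S k)) /\
    e 0 = u (fun k => e (S (r k))) x).
  { intros e. split; [intros [x [-> H]]; exact H |].
    intros H. eexists; split; [reflexivity|exact H]. }
  apply D_ex. apply D_and.
  - exact (D_ren (fun k => match k with 0 => 0 | S k => S (S k) end) Ht).
  - exact (D_ren (fun k => match k with 0 => 1 | 1 => 0 | S (S k) => S (S (r k)) end) Hu).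
Qed.

Lemma D_eq t u : T t -> T u -> D (fun e => t e = u e).
Proof.
  intros Ht Hu. apply (D_app (P := fun e x => x = u e) (fun k => k)); [|exact Ht].
  exact Hu.
Qed.

Lemma D_mem t u : T t -> T u -> D (fun e => t e ∈ u e).
Proof.
  intros Ht Hu. apply (D_app (P := fun e x => x ∈ u e) (fun k => k)); [|exact Ht].
  apply (D_app (P := fun e x => e 0 ∈ x) (fun k => k)).
  - exact (D_mem_var 1 0).
  - exact (T_ren S Hu).
Qed.

(** * Definite description inside the structure *)

Lemma empty_exists : exists x : M, is_empty x.
Proof.
  destruct (ZF_infinity HZF) as [x [[e [He _]] _]]. exists e. exact He.
Qed.

Definition carrier_inhabited : inhabited M :=
  match empty_exists with ex_intro _ x _ => inhabits x end.

(** Definite description; the value is [∅] when [P] is not satisfied by exactly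
    one element, which makes [the P] definable for every definable [P]. *)
Definition the (P : M -> Prop) : M :=
  epsilon carrier_inhabited (fun y => (P y /\ forall z, P z -> z = y) \/
    (~ (exists x, P x /\ forall z, P z -> z = x) /\ is_empty y)).

Lemma set_ext (x y : M) : (forall z, z ∈ x <-> z ∈ y) -> x = y.
Proof. apply (ZF_extensionality HZF). Qed.

(** The condition inside [epsilon] has exactly one solution, so the metatheoretic choice operator
    brings no choice into [M], and the value is characterised by a first-order condition. *)
Lemma the_graph P y : y = the P <-> (P y /\ forall z, P z -> z = y) \/
    (~ (exists x, P x /\ forall z, P z -> z = x) /\ is_empty y).
Proof.
  assert (H : exists y, (P y /\ forall z, P z -> z = y) \/
    (~ (exists x, P x /\ forall z, P z -> z = x) /\ is_empty y)).
  { destruct (classic (exists x, P x /\ forall z, P z -> z = x)) as [[x Hx]|N].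
    - exists x. auto.
    - destruct empty_exists as [x Hx]. exists x. auto. }
  assert (Hs := epsilon_spec carrier_inhabited _ H). fold (the P) in Hs.
  split.
  - intros ->. exact Hs.
  - intros [[Hy Hu]|[N E]]; destruct Hs as [[Hz Hv]|[N' E']].
    + apply Hv, Hy.
    + exfalso. apply N'. eauto.
    + exfalso. apply N. eauto.
    + apply set_ext. intros z. specialize (E z). specialize (E' z). tauto.
Qed.

Lemma the_spec P : (exists y, P y) -> (forall y z, P y -> P z -> y = z) -> P (the P).
Proof.
  intros [y Hy] Hu.
  replace (the P) with y; [exact Hy|].
  apply the_graph. left. split; [exact Hy|]. intros z Hz. apply Hu; assumption.
Qed.

Lemma the_eq P y : P y -> (forall z, P z -> z = y) -> the P = y.
Proof. intros. symmetry. apply the_graph. auto. Qed.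

Lemma T_the (P : (nat -> M) -> M -> Prop) :
  D (fun e => P (fun k => e (S k)) (e 0)) -> T (fun e => the (P e)).
Proof.
  intros HP.
  assert (Hr : forall i r, D (fun e => P (fun k => e (r k)) (e i))).
  { intros i r. exact (D_app r HP (T_var i)). }
  unfold T. eapply D_ext.
  { intros e. symmetry. apply the_graph. }
  apply D_or; [apply D_and; [apply Hr|]|apply D_and; [apply D_not|]].
  - apply D_all. apply D_imp; [apply Hr|apply D_eq_var].
  - apply D_ex. apply D_and; [apply Hr|].
    apply D_all. apply D_imp; [apply Hr|apply D_eq_var].
  - unfold is_empty. apply D_all. apply D_not, D_mem_var.
Qed.

(** * Automation of definability proofs *)

Definition D1 (P : M -> Prop) : Prop := D (fun e => P (e 0)).
Definition T1 (t : M -> M) : Prop := T (fun e => t (e 0)).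
Definition T2 (t : M -> M -> M) : Prop := T (fun e => t (e 0) (e 1)).

Lemma D1_app P t : D1 P -> T t -> D (fun e => P (t e)).
Proof. intros HP. exact (D_app (P := fun _ => P) (fun k => k) HP). Qed.

Lemma T1_app u t : T1 u -> T t -> T (fun e => u (t e)).
Proof. intros Hu. exact (T_app (u := fun _ => u) (fun k => k) Hu). Qed.

Lemma T2_app v t u : T2 v -> T t -> T u -> T (fun e => v (t e) (u e)).
Proof.
  intros Hv Ht Hu. apply (T_app (u := fun e x => v x (u e)) (fun k => k)); [|exact Ht].
  apply (T_app (u := fun e x => v (e 0) x) (fun k => k)); [|exact (T_ren S Hu)].
  exact (T_ren (fun k => match k with 0 => 1 | _ => 0 end) Hv).
Qed.

Lemma T_app2 (r : nat -> nat) (u : (nat -> M) -> M -> M -> M) t v :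
  T (fun e => u (fun k => e (S (S k))) (e 0) (e 1)) -> T t -> T v ->
  T (fun e => u (fun k => e (r k)) (t e) (v e)).
Proof.
  intros Hu Ht Hv.
  apply (T_app (u := fun e x => u (fun k => e (r k)) x (v e)) (fun k => k)); [|exact Ht].
  apply (T_app (u := fun e x => u (fun k => e (S (r k))) (e 0) x) (fun k => k));
    [|exact (T_ren S Hv)].
  exact (T_ren (fun k => match k with 0 => 1 | 1 => 0 | S (S k) => S (S (r k)) end) Hu).
Qed.

(** Decomposes a goal by the shape of its body. Hypotheses [D1], [T1], [T2] and their versions with
    an environment handle abstract predicates and operations; each later set operation registers its
    own lemma as a hint. *)
Ltac definability_step :=
  cbv beta;
  first
  [ assumption
  | match goal with
    | H : D1 ?P |- D (fun e => ?P (@?t e)) => refine (D1_app H _)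
    | H : T1 ?P |- T (fun e => ?P (@?t e)) => refine (T1_app H _)
    | H : T2 ?P |- T (fun e => ?P (@?t e) (@?u e)) => refine (T2_app H _ _)
    | |- D1 ?P => red
    | |- T1 ?P => red
    | |- T2 ?P => red
    | |- T (fun e => e ?i) => exact (T_var i)
    | |- T (fun e => ?c) => exact (T_const c)
    | H : T ?t |- T (fun e => ?t (fun k => e (@?r k))) => exact (T_ren r H)
    | H : D ?t |- D (fun e => ?t (fun k => e (@?r k))) => exact (D_ren r H)
    | H : D (fun e => ?P (fun k => e (S k)) (e 0))
        |- D (fun e => ?P (fun k => e (@?r k)) (@?t e)) => refine (D_app r H _)
    | H : T (fun e => ?P (fun k => e (S k)) (e 0))
        |- T (fun e => ?P (fun k => e (@?r k)) (@?t e)) => refine (T_app r H _)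
    | H : T (fun e => ?u (fun k => e (S (S k))) (e 0) (e 1))
        |- T (fun e => ?u (fun k => e (@?r k)) (@?t e) (@?v e)) =>
        refine (T_app2 r H _ _)
    | |- D (fun e => _ /\ _) => simple apply D_and
    | |- D (fun e => _ \/ _) => simple apply D_or
    | |- D (fun e => _ <-> _) => simple apply D_iff
    | |- D (fun e => ~ _) => simple apply D_not
    | |- D (fun e => exists x, _) => simple apply D_ex
    | |- D (fun e => _ -> _) => simple apply D_imp
    | |- D (fun e => _ = _) => simple apply D_eq
    | |- D (fun e => _ ∈ _) => simple apply D_mem
    | |- D (fun e => False) => exact D_False
    | |- D (fun e => forall x, _) => simple apply D_all
    | |- T (fun e => the _) => simple apply T_the
    end ].

#[local] Hint Extern 1 (D _) => definability_step : definability.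
#[local] Hint Extern 1 (T _) => definability_step : definability.
#[local] Hint Extern 1 (D1 _) => definability_step : definability.
#[local] Hint Extern 1 (T1 _) => definability_step : definability.
#[local] Hint Extern 1 (T2 _) => definability_step : definability.
Ltac definability := solve [auto 100 with definability nocore].

(** * Basic set operations from the axioms *)

Lemma D_subset t u : T t -> T u -> D (fun e => t e ⊆ u e).
Proof. intros. unfold subset. definability. Qed.
#[local] Hint Resolve D_subset : definability.
Definition empty : M := the (fun x => is_empty x).
Definition upair (x y : M) : M := the (fun p => forall z, z ∈ p <-> z = x \/ z = y).
Definition Union (x : M) : M := the (fun u => forall z, z ∈ u <-> exists y, y ∈ x /\ z ∈ y).
Definition power (x : M) : M := the (fun p => forall z, z ∈ p <-> z ⊆ x).
Definition sep (a : M) (P : M -> Prop) : M :=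
  the (fun b => forall z, z ∈ b <-> z ∈ a /\ P z).
Definition img (a : M) (t : M -> M) : M :=
  the (fun b => forall y, y ∈ b <-> exists x, x ∈ a /\ y = t x).

(** Extensionality supplies the uniqueness, so the bare existence statement of an axiom suffices to
    name its set. *)
Lemma the_set (P : M -> Prop) :
  (exists b, forall z, z ∈ b <-> P z) ->
  forall z, z ∈ the (fun b => forall z, z ∈ b <-> P z) <-> P z.
Proof.
  intros [b Hb]. apply (the_spec (P := fun b => forall z, z ∈ b <-> P z)).
  - exists b. exact Hb.
  - intros y z Hy Hz. apply set_ext. intros x. rewrite Hy, Hz. reflexivity.
Qed.

Lemma in_empty z : ~ z ∈ empty.
Proof.
  assert (H : is_empty empty).
  { unfold empty. apply the_spec; [exact empty_exists|].
    intros y x Hy Hx. apply set_ext. intros u. specialize (Hy u). specialize (Hx u). tauto. }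
  apply H.
Qed.

Lemma in_upair x y z : z ∈ upair x y <-> z = x \/ z = y.
Proof. apply (the_set (P := fun z => z = x \/ z = y)), (ZF_pairing HZF). Qed.

Lemma in_Union x z : z ∈ Union x <-> exists y, y ∈ x /\ z ∈ y.
Proof. apply (the_set (P := fun z => exists y, y ∈ x /\ z ∈ y)), (ZF_union HZF). Qed.

Lemma in_power x z : z ∈ power x <-> z ⊆ x.
Proof. apply (the_set (P := fun z => z ⊆ x)), (ZF_powerset HZF). Qed.

Lemma in_sep a P z : D1 P -> (z ∈ sep a P <-> z ∈ a /\ P z).
Proof.
  intros HP. apply (the_set (P := fun z => z ∈ a /\ P z)).
  destruct (D_binder (P := fun _ => P) HP) as [p [r Hp]].
  destruct (ZF_separation HZF p (valuation r (fun _ => a)) a) as [b Hb].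
  exists b. intros x. rewrite Hb, <- Hp. reflexivity.
Qed.

Lemma in_img a t y : T1 t -> (y ∈ img a t <-> exists x, x ∈ a /\ y = t x).
Proof.
  intros Ht. apply (the_set (P := fun y => exists x, x ∈ a /\ y = t x)).
  assert (H : D (fun e => e 1 = t (e 0))) by definability.
  destruct (D_binder (P := fun e x => e 0 = t x) H) as [p [r Hp]].
  (* Replacement expects the argument at index 0 and the value at index 1. Indices that stand for
     the value therefore go to 1, and all other ones move past both. *)
  set (q := rename (fun i => match i with 0 => 0 | S k => match r k with
     inl 0 => 1 | _ => S (S k) end end) p).
  assert (Hq : forall x y,
    sat (env_cons x (env_cons y (valuation r (fun _ => a)))) q <-> y = t x).
  { intros x z. unfold q. rewrite sat_rename.
    rewrite (Hp (env_cons z (fun _ => a)) x : z = t x <-> _).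
    match goal with |- sat ?a _ <-> sat ?b _ => replace b with a; [reflexivity|] end.
    apply functional_extensionality. intros [|k]; [reflexivity|].
    unfold valuation. simpl. destruct (r k) as [[|j]|c] eqn:E; simpl; try rewrite E; reflexivity. }
  destruct (ZF_replacement HZF (p := q) (e := valuation r (fun _ => a)) (a := a)) as [b Hb].
  { intros x z z' _. rewrite !Hq. congruence. }
  exists b. intros z. rewrite Hb. split; intros [x [Hx Hz]]; exists x;
    (split; [exact Hx|]); apply Hq, Hz.
Qed.


Lemma T_upair t u : T t -> T u -> T (fun e => upair (t e) (u e)).
Proof. intros. unfold upair. definability. Qed.
#[local] Hint Resolve T_upair : definability.
Lemma T_Union t : T t -> T (fun e => Union (t e)).
Proof. intros. unfold Union. definability. Qed.
#[local] Hint Resolve T_Union : definability.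
Lemma T_power t : T t -> T (fun e => power (t e)).
Proof. intros. unfold power, subset. definability. Qed.
#[local] Hint Resolve T_power : definability.
Lemma T_sep t (P : (nat -> M) -> M -> Prop) :
  T t -> D (fun e => P (fun k => e (S k)) (e 0)) -> T (fun e => sep (t e) (P e)).
Proof. intros. unfold sep. definability. Qed.
#[local] Hint Resolve T_sep : definability.
Lemma T_img t (u : (nat -> M) -> M -> M) :
  T t -> T (fun e => u (fun k => e (S k)) (e 0)) -> T (fun e => img (t e) (u e)).
Proof. intros. unfold img. definability. Qed.
#[local] Hint Resolve T_img : definability.


(** * Unions, ordered pairs and functions as graphs *)

Definition cup (x y : M) : M := Union (upair x y).
Definition add (x a : M) : M := cup x (upair a a).
Definition opair (x y : M) : M := upair (upair x x) (upair x y).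
Definition lam (X : M) (t : M -> M) : M := img X (fun x => opair x (t x)).
(** A total operation: where [h] has no value or several values at [x], the result is the empty
    set. *)
Definition app (h x : M) : M := the (fun y => opair x y ∈ h).
Definition bigcup (X : M) (t : M -> M) : M := Union (img X t).

Lemma T_cup t u : T t -> T u -> T (fun e => cup (t e) (u e)).
Proof. intros. unfold cup. definability. Qed.
#[local] Hint Resolve T_cup : definability.
Lemma T_add t u : T t -> T u -> T (fun e => add (t e) (u e)).
Proof. intros. unfold add, cup. definability. Qed.
#[local] Hint Resolve T_add : definability.
Lemma T_opair t u : T t -> T u -> T (fun e => opair (t e) (u e)).
Proof. intros. unfold opair. definability. Qed.
#[local] Hint Resolve T_opair : definability.
Lemma T_apply t u : T t -> T u -> T (fun e => app (t e) (u e)).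
Proof. intros. unfold app, opair. definability. Qed.
#[local] Hint Resolve T_apply : definability.
Lemma T_lam t (u : (nat -> M) -> M -> M) :
  T t -> T (fun e => u (fun k => e (S k)) (e 0)) -> T (fun e => lam (t e) (u e)).
Proof. intros. unfold lam, opair. definability. Qed.
#[local] Hint Resolve T_lam : definability.
Lemma T_bigcup t (u : (nat -> M) -> M -> M) :
  T t -> T (fun e => u (fun k => e (S k)) (e 0)) -> T (fun e => bigcup (t e) (u e)).
Proof. intros. unfold bigcup. definability. Qed.
#[local] Hint Resolve T_bigcup : definability.


Lemma in_cup x y z : z ∈ cup x y <-> z ∈ x \/ z ∈ y.
Proof.
  unfold cup. rewrite in_Union. split.
  - intros [u [Hu Hz]]. apply in_upair in Hu as [-> | ->]; auto.
  - intros [H|H]; eexists; (split; [apply in_upair|exact H]); auto.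
Qed.

Lemma in_add x a z : z ∈ add x a <-> z ∈ x \/ z = a.
Proof. unfold add. rewrite in_cup, in_upair. tauto. Qed.

Lemma in_bigcup X t z : T1 t -> (z ∈ bigcup X t <-> exists x, x ∈ X /\ z ∈ t x).
Proof.
  intros Ht. unfold bigcup. rewrite in_Union. split.
  - intros [y [Hy Hz]]. apply in_img in Hy as [x [Hx ->]]; [|exact Ht]. eauto.
  - intros [x [Hx Hz]]. exists (t x). split; [apply in_img; eauto|exact Hz].
Qed.

Lemma upair_inj x y x' y' : upair x y = upair x' y' ->
  (x = x' /\ y = y') \/ (x = y' /\ y = x').
Proof.
  intros E.
  assert (H1 := proj2 (in_upair x y x) (or_introl eq_refl)).
  assert (H2 := proj2 (in_upair x y y) (or_intror eq_refl)).
  assert (H3 := proj2 (in_upair x' y' x') (or_introl eq_refl)).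
  assert (H4 := proj2 (in_upair x' y' y') (or_intror eq_refl)).
  rewrite E in H1, H2. rewrite <- E in H3, H4.
  rewrite in_upair in *.
  intuition congruence.
Qed.

Lemma opair_inj x y x' y' : opair x y = opair x' y' -> x = x' /\ y = y'.
Proof.
  intros E. apply upair_inj in E as [[E1 E2]|[E1 E2]];
  apply upair_inj in E1; apply upair_inj in E2; intuition congruence.
Qed.

Lemma in_lam X t x y : T1 t -> (opair x y ∈ lam X t <-> x ∈ X /\ y = t x).
Proof.
  intros Ht. unfold lam. rewrite in_img by definability. split.
  - intros [u [Hu E]]. apply opair_inj in E as [-> ->]. auto.
  - intros [Hx ->]. eauto.
Qed.

Lemma app_lam X t x : T1 t -> x ∈ X -> app (lam X t) x = t x.
Proof.
  intros Ht Hx. apply the_eq.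
  - apply in_lam; auto.
  - intros z Hz. apply in_lam in Hz; [tauto|exact Ht].
Qed.

Lemma lam_ext X t u : T1 t -> T1 u -> (forall x, x ∈ X -> t x = u x) ->
  lam X t = lam X u.
Proof.
  intros Ht Hu H. apply set_ext. intros z. unfold lam.
  rewrite !in_img by definability.
  split; intros [x [Hx ->]]; exists x; (split; [exact Hx|]); rewrite H; auto.
Qed.

Lemma mem_irrefl (x : M) : ~ x ∈ x.
Proof.
  intros H. destruct (ZF_foundation HZF (x := upair x x)) as [y [Hy Hm]].
  - exists x. apply in_upair. auto.
  - apply in_upair in Hy. assert (y = x) by tauto. subst y.
    apply (Hm x); [apply in_upair; auto|exact H].
Qed.

Lemma mem_asym (x y : M) : x ∈ y -> y ∈ x -> False.
Proof.
  intros H K. destruct (ZF_foundation HZF (x := upair x y)) as [z [Hz Hm]].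
  - exists x. apply in_upair. auto.
  - apply in_upair in Hz as [-> | ->].
    + apply (Hm y); [apply in_upair; auto|exact K].
    + apply (Hm x); [apply in_upair; auto|exact H].
Qed.

Lemma sub_refl (x : M) : x ⊆ x.
Proof. intros z. auto. Qed.

Lemma sub_trans (x y z : M) : x ⊆ y -> y ⊆ z -> x ⊆ z.
Proof. intros H K u. auto. Qed.

(** * Finite sets *)

(** Kuratowski's definition, equivalent to [is_finite] (see [fin_is_finite])
    but better suited to induction. *)
Definition fin (a : M) : Prop :=
  forall C, empty ∈ C -> (forall b x, b ∈ C -> x ∈ a -> add b x ∈ C) -> a ∈ C.

Lemma D_fin t : T t -> D (fun e => fin (t e)).
Proof. intros. unfold fin. definability. Qed.
#[local] Hint Resolve D_fin : definability.

Lemma fin_empty : fin empty.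
Proof. intros C H _. exact H. Qed.

Lemma fin_add a x : fin a -> fin (add a x).
Proof.
  intros Ha C H0 HS. apply HS; [|apply in_add; auto].
  apply Ha; [exact H0|]. intros b y Hb Hy. apply HS; [exact Hb|].
  apply in_add. auto.
Qed.


(** The definition is applied to the family of finite subsets of [a] that satisfy [P]; hence the
    step may assume that [b] is finite and contained in [a]. *)
Lemma fin_ind (P : M -> Prop) a : D1 P -> P empty ->
  (forall b x, fin b -> b ⊆ a -> x ∈ a -> P b -> P (add b x)) -> fin a -> P a.
Proof.
  intros HP H0 HS Ha.
  assert (H : a ∈ sep (power a) (fun b => fin b /\ P b)).
  { apply Ha.
    - apply in_sep; [definability|]. split; [|split; [apply fin_empty|exact H0]].
      apply in_power. intros z Hz. destruct (in_empty Hz).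
    - intros b x Hb Hx. apply in_sep in Hb as [Hb [Fb Pb]]; [|definability].
      apply in_power in Hb.
      apply in_sep; [definability|]. split; [|split; [apply fin_add, Fb|auto]].
      apply in_power. intros z Hz. apply in_add in Hz as [Hz| ->]; auto. }
  apply in_sep in H; [tauto|definability].
Qed.

Lemma add_sub b x c : b ⊆ c -> x ∈ c -> add b x ⊆ c.
Proof. intros H K z Hz. apply in_add in Hz as [Hz| ->]; auto. Qed.

Lemma add_mem b x : x ∈ b -> add b x = b.
Proof.
  intros H. apply set_ext. intros z. rewrite in_add. intuition congruence.
Qed.

Lemma sub_empty x : x ⊆ empty -> x = empty.
Proof.
  intros H. apply set_ext. intros z. split; [apply H|].
  intros K. destruct (in_empty K).
Qed.

Lemma fin_sub a c : fin a -> c ⊆ a -> fin c.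
Proof.
  intros Ha. revert c.
  apply (fin_ind (P := fun a => forall c, c ⊆ a -> fin c)); [definability| | |exact Ha].
  - intros c Hc. rewrite (sub_empty Hc). apply fin_empty.
  - intros b x Fb _ _ IH c Hc.
    set (c' := sep c (fun y => y <> x)).
    assert (Hc' : forall y, y ∈ c' <-> y ∈ c /\ y <> x) by (intros y; apply in_sep; definability).
    assert (F' : fin c').
    { apply IH. intros y Hy. apply Hc' in Hy as [Hy N]. apply Hc in Hy.
      apply in_add in Hy. tauto. }
    destruct (classic (x ∈ c)) as [Hx|Hx].
    + replace c with (add c' x); [apply fin_add, F'|].
      apply set_ext. intros y. rewrite in_add, Hc'.
      destruct (classic (y = x)) as [->|N]; tauto.
    + replace c with c'; [exact F'|].
      apply set_ext. intros y. rewrite Hc'. intuition congruence.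
Qed.

Lemma fin_cup a b : fin a -> fin b -> fin (cup a b).
Proof.
  intros Ha Hb.
  apply (fin_ind (P := fun b => fin (cup a b))) with (a := b); [definability| | |exact Hb].
  - apply fin_sub with a; [exact Ha|]. intros z Hz.
    apply in_cup in Hz as [Hz|Hz]; [exact Hz|destruct (in_empty Hz)].
  - intros c x _ _ _ IH. apply fin_sub with (add (cup a c) x); [apply fin_add, IH|].
    intros z. rewrite in_cup, !in_add, in_cup. tauto.
Qed.

Lemma fin_img a t : T1 t -> fin a -> fin (img a t).
Proof.
  intros Ht Ha.
  apply (fin_ind (P := fun a => fin (img a t))); [definability| | |exact Ha].
  - apply fin_sub with empty; [apply fin_empty|]. intros z Hz.
    apply in_img in Hz as [x [Hx _]]; [destruct (in_empty Hx)|exact Ht].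
  - intros c x _ _ _ IH. apply fin_sub with (add (img c t) (t x)); [apply fin_add, IH|].
    intros z Hz. apply in_img in Hz as [y [Hy ->]]; [|exact Ht].
    apply in_add. apply in_add in Hy as [Hy| ->]; [left|right; reflexivity].
    apply in_img; eauto.
Qed.

Lemma fin_bigcup a t : T1 t -> fin a -> (forall x, x ∈ a -> fin (t x)) ->
  fin (bigcup a t).
Proof.
  intros Ht Ha.
  apply (fin_ind (P := fun a => (forall x, x ∈ a -> fin (t x)) -> fin (bigcup a t)));
    [definability| | |exact Ha].
  - intros _. apply fin_sub with empty; [apply fin_empty|]. intros z Hz.
    apply in_bigcup in Hz as [x [Hx _]]; [destruct (in_empty Hx)|exact Ht].
  - intros c x _ _ _ IH H.
    apply fin_sub with (cup (bigcup c t) (t x)).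
    + apply fin_cup; [apply IH; intros y Hy|]; apply H, in_add; auto.
    + intros z Hz. apply in_bigcup in Hz as [y [Hy Hz]]; [|exact Ht].
      apply in_cup. apply in_add in Hy as [Hy| ->]; [left|right; exact Hz].
      apply in_bigcup; eauto.
Qed.

(** A subset of [add b x] is a subset of [b], or such a subset with [x] added. *)
Lemma fin_power a : fin a -> fin (power a).
Proof.
  apply (fin_ind (P := fun a => fin (power a))); [definability| |].
  - apply fin_sub with (add empty empty); [apply fin_add, fin_empty|].
    intros z Hz. apply in_power, sub_empty in Hz. apply in_add. auto.
  - intros b x _ _ _ IH.
    apply fin_sub with (cup (power b) (img (power b) (fun c => add c x))).
    + apply fin_cup; [exact IH|]. apply fin_img; [definability|exact IH].
    + intros c Hc. apply in_power in Hc. apply in_cup.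
      set (c' := sep c (fun y => y <> x)).
      assert (Hc' : forall y, y ∈ c' <-> y ∈ c /\ y <> x) by (intros y; apply in_sep; definability).
      assert (K : c' ∈ power b).
      { apply in_power. intros y Hy. apply Hc' in Hy as [Hy N]. apply Hc, in_add in Hy. tauto. }
      destruct (classic (x ∈ c)) as [Hx|Hx]; [right|left].
      * apply in_img; [definability|]. exists c'. split; [exact K|].
        apply set_ext. intros y. rewrite in_add, Hc'.
        destruct (classic (y = x)) as [->|N]; tauto.
      * replace c with c'; [exact K|].
        apply set_ext. intros y. rewrite Hc'. intuition congruence.
Qed.

(** [X] is covered by the image of [img X t] under the inverse of [t], which is definable by
    description. *)
Lemma fin_inj X t : T1 t ->
  (forall x y, x ∈ X -> y ∈ X -> t x = t y -> x = y) -> fin (img X t) -> fin X.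
Proof.
  intros Ht Hi HF.
  apply fin_sub with (img (img X t) (fun y => the (fun x => x ∈ X /\ t x = y))).
  - apply fin_img; [definability|exact HF].
  - intros x Hx. apply in_img; [definability|]. exists (t x).
    split; [apply in_img; eauto|]. symmetry. apply the_eq; [auto|].
    intros z [Hz E]. auto.
Qed.


(** * Injections, natural numbers and ordinals *)

Definition cond (P : Prop) (a b : M) : M :=
  the (fun z => (P /\ z = a) \/ (~ P /\ z = b)).

Lemma T_cond P t u : D P -> T t -> T u -> T (fun e => cond (P e) (t e) (u e)).
Proof. intros. unfold cond. definability. Qed.
#[local] Hint Resolve T_cond : definability.

Lemma cond_true (P : Prop) a b : P -> cond P a b = a.
Proof. intros H. apply the_eq; [auto|]. intros z [[_ E]|[N _]]; tauto. Qed.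

Lemma cond_false (P : Prop) a b : ~ P -> cond P a b = b.
Proof. intros H. apply the_eq; [auto|]. intros z [[N _]|[_ E]]; tauto. Qed.

(** Read through [app], so that only the values of [h] on [X] matter. *)
Definition injects (X Y : M) : Prop :=
  exists h, (forall x, x ∈ X -> app h x ∈ Y) /\
    (forall x x', x ∈ X -> x' ∈ X -> app h x = app h x' -> x = x').

Lemma D_injects t u : T t -> T u -> D (fun e => injects (t e) (u e)).
Proof. intros. unfold injects. definability. Qed.
#[local] Hint Resolve D_injects : definability.

Lemma D_transitive_set t : T t -> D (fun e => transitive_set (t e)).
Proof. intros. unfold transitive_set. definability. Qed.
#[local] Hint Resolve D_transitive_set : definability.


Lemma injects_intro X Y t : T1 t -> (forall x, x ∈ X -> t x ∈ Y) ->
  (forall x x', x ∈ X -> x' ∈ X -> t x = t x' -> x = x') -> injects X Y.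
Proof.
  intros Ht Hm Hi. exists (lam X t). split.
  - intros x Hx. rewrite app_lam; auto.
  - intros x x' Hx Hx'. rewrite !app_lam; auto.
Qed.

Lemma injects_sub X Y : X ⊆ Y -> injects X Y.
Proof. intros H. apply injects_intro with (fun x => x); [definability|exact H|auto]. Qed.

Lemma injects_trans X Y Z : injects X Y -> injects Y Z -> injects X Z.
Proof.
  intros [f [Hf If]] [g [Hg Ig]].
  apply injects_intro with (fun x => app g (app f x)); [definability|auto|].
  intros x x' Hx Hx' E. apply If; auto.
Qed.

Lemma injects_empty X : injects empty X.
Proof. apply injects_sub. intros z Hz. destruct (in_empty Hz). Qed.

(** The point of [X] that is sent to [y], if there is one, is redirected to the value of [x], which
    no point of [X] takes. *)
Lemma injects_swap X x Y y : x ∉ X -> injects (add X x) (add Y y) -> injects X Y.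
Proof.
  intros Hx [h [Hh Ih]].
  assert (HX : forall u, u ∈ X -> u ∈ add X x) by (intros; apply in_add; auto).
  assert (Hxx : x ∈ add X x) by (apply in_add; auto).
  assert (Hne : forall u, u ∈ X -> app h u <> app h x).
  { intros u Hu E. apply Ih in E; auto. subst. tauto. }
  apply injects_intro with (fun u => cond (app h u = y) (app h x) (app h u)); [definability| |].
  - intros u Hu. destruct (classic (app h u = y)) as [E|E].
    + rewrite cond_true by exact E. destruct (proj1 (in_add _ _ _) (Hh x Hxx)) as [K|K]; [exact K|].
      destruct (Hne u Hu). congruence.
    + rewrite cond_false by exact E. destruct (proj1 (in_add _ _ _) (Hh u (HX u Hu))); tauto.
  - intros u v Hu Hv.
    destruct (classic (app h u = y)) as [E|E]; [rewrite (cond_true _ _ E)|rewrite (cond_false _ _ E)];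
    (destruct (classic (app h v = y)) as [E'|E']; [rewrite (cond_true _ _ E')|rewrite (cond_false _ _ E')]);
    intros K.
    + apply Ih; auto. congruence.
    + destruct (Hne v Hv). congruence.
    + destruct (Hne u Hu). congruence.
    + apply Ih; auto.
Qed.

Definition succ (m : M) : M := add m m.

Lemma inductive_iff x :
  inductive_set x <-> empty ∈ x /\ forall y, y ∈ x -> succ y ∈ x.
Proof.
  assert (He : forall e : M, is_empty e <-> e = empty).
  { intros e. split; [intros H; apply sub_empty; intros z Hz; destruct (H z Hz)|].
    intros -> z Hz. exact (in_empty Hz). }
  assert (Hs : forall s y : M, is_succ s y <-> s = succ y).
  { intros s y. split.
    - intros H. apply set_ext. intros z. rewrite (H z). unfold succ.
      rewrite in_add. reflexivity.
    - intros -> z. apply in_add. }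
  unfold inductive_set. split.
  - intros [[e [Ee He']] H]. apply He in Ee. subst e. split; [exact He'|].
    intros y Hy. destruct (H y Hy) as [s [Es Hs']]. apply Hs in Es. subst s. exact Hs'.
  - intros [H0 H]. split; [exists empty; split; [apply He; reflexivity|exact H0]|].
    intros y Hy. exists (succ y). split; [apply Hs; reflexivity|auto].
Qed.

Definition omega : M := the (fun w => is_omega w).

Lemma omega_unique (v w : M) : is_omega v -> is_omega w -> v = w.
Proof.
  intros [Iv Lv] [Iw Lw]. apply set_ext. intros z.
  split; [apply Lv, Iw|apply Lw, Iv].
Qed.

Lemma omega_spec : is_omega omega.
Proof.
  apply (the_spec (P := fun w => is_omega w)); [|exact omega_unique].
  destruct (ZF_infinity HZF) as [x Hx].
  set (P := fun z => forall v, empty ∈ v -> (forall y, y ∈ v -> succ y ∈ v) -> z ∈ v).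
  assert (HP : D1 P) by (unfold P, succ; definability).
  exists (sep x P). split.
  - apply inductive_iff in Hx as [H0 HS]. apply inductive_iff. split.
    + apply in_sep; [exact HP|]. split; [exact H0|]. intros v Hv _. exact Hv.
    + intros y Hy. apply in_sep in Hy as [Hy Py]; [|exact HP].
      apply in_sep; [exact HP|]. split; [auto|].
      intros v H0' HS'. apply HS', Py; assumption.
  - intros v Hv z Hz. apply in_sep in Hz as [_ Pz]; [|exact HP].
    apply inductive_iff in Hv as [H0 HS]. apply Pz; assumption.
Qed.

Lemma omega_0 : empty ∈ omega.
Proof. apply (proj1 (inductive_iff omega)), omega_spec. Qed.

Lemma omega_succ m : m ∈ omega -> succ m ∈ omega.
Proof. apply (proj1 (inductive_iff omega)), omega_spec. Qed.

Lemma omega_ind (P : M -> Prop) : D1 P -> P empty ->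
  (forall m, m ∈ omega -> P m -> P (succ m)) -> forall m, m ∈ omega -> P m.
Proof.
  intros HP H0 HS m Hm.
  assert (H : m ∈ sep omega P).
  { apply omega_spec; [|exact Hm]. apply inductive_iff. split.
    - apply in_sep; [exact HP|]. split; [exact omega_0|exact H0].
    - intros y Hy. apply in_sep in Hy as [Hy Py]; [|exact HP].
      apply in_sep; [exact HP|]. split; [apply omega_succ, Hy|auto]. }
  apply in_sep in H; tauto.
Qed.

Lemma omega_cases m : m ∈ omega -> m = empty \/ exists k, k ∈ omega /\ m = succ k.
Proof.
  revert m. apply omega_ind; [unfold succ; definability|auto|]. intros m Hm _. eauto.
Qed.

(** With Foundation, ordinals are the transitive sets of transitive sets; this form is simpler to
    check than [is_ordinal]. *)
Definition ord (x : M) : Prop :=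
  transitive_set x /\ forall y, y ∈ x -> transitive_set y.

Lemma D_ord t : T t -> D (fun e => ord (t e)).
Proof. intros. unfold ord. definability. Qed.
#[local] Hint Resolve D_ord : definability.

Lemma T_succ t : T t -> T (fun e => succ (t e)).
Proof. intros. unfold succ. definability. Qed.
#[local] Hint Resolve T_succ : definability.


Lemma in_succ m z : z ∈ succ m <-> z ∈ m \/ z = m.
Proof. apply in_add. Qed.

Lemma ordinal_ord (x : M) : is_ordinal x -> ord x.
Proof.
  intros [Ht [_ [Htr _]]]. split; [exact Ht|].
  intros y Hy z Hz u Hu.
  assert (Hzx := Ht y Hy z Hz). assert (Hux := Ht z Hzx u Hu).
  exact (Htr u z y Hux Hzx Hy Hu Hz).
Qed.

Lemma ord_trans x y z : ord x -> y ∈ x -> z ∈ y -> z ∈ x.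
Proof. intros [Hx _] Hy Hz. exact (Hx y Hy z Hz). Qed.

Lemma ord_elem x y : ord x -> y ∈ x -> ord y.
Proof.
  intros [Hx Hx'] Hy. split; [auto|]. intros z Hz. exact (Hx' z (Hx y Hy z Hz)).
Qed.

Lemma ord_succ x : ord x -> ord (succ x).
Proof.
  intros [Hx Hx']. split.
  - intros y Hy z Hz. apply in_succ. apply in_succ in Hy as [Hy| ->]; left; [|exact Hz].
    exact (Hx y Hy z Hz).
  - intros y Hy. apply in_succ in Hy as [Hy| ->]; auto.
Qed.

Lemma ord_least (P : M -> Prop) a : D1 P -> ord a -> P a ->
  exists b, ord b /\ P b /\ (b ∈ a \/ b = a) /\ forall c, c ∈ b -> ~ P c.
Proof.
  intros HP Ha Pa.
  destruct (ZF_foundation HZF (x := sep (succ a) P)) as [b [Hb Hm]].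
  - exists a. apply in_sep; [exact HP|]. split; [apply in_succ; auto|exact Pa].
  - apply in_sep in Hb as [Hb Pb]; [|exact HP].
    assert (Ob : ord b) by (apply ord_elem with (succ a); [apply ord_succ, Ha|exact Hb]).
    exists b. split; [exact Ob|]. split; [exact Pb|]. split; [apply in_succ, Hb|].
    intros c Hc Pc. apply (Hm c); [|exact Hc].
    apply in_sep; [exact HP|]. split; [|exact Pc].
    exact (ord_trans (ord_succ Ha) Hb Hc).
Qed.

Lemma ord_ind (P : M -> Prop) : D1 P ->
  (forall x, ord x -> (forall y, y ∈ x -> P y) -> P x) -> forall x, ord x -> P x.
Proof.
  intros HP H x Hx. apply NNPP. intros N.
  destruct (ord_least (P := fun x => ~ P x) (a := x)) as [b [Ob [Nb [_ Hb]]]];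
    [definability|exact Hx|exact N|].
  apply Nb, H; [exact Ob|]. intros y Hy. apply NNPP, Hb, Hy.
Qed.

(** Double induction. Unless an element of one ordinal equals or contains the other ordinal, the
    induction hypotheses put every element of each into the other. *)
Lemma ord_trichotomy x y : ord x -> ord y -> x ∈ y \/ x = y \/ y ∈ x.
Proof.
  intros Hx. revert y.
  apply (ord_ind (P := fun x => forall y, ord y -> x ∈ y \/ x = y \/ y ∈ x));
    [definability| |exact Hx].
  clear x Hx. intros x Hx IHx.
  apply (ord_ind (P := fun y => x ∈ y \/ x = y \/ y ∈ x)); [definability|].
  intros y Hy IHy.
  destruct (classic (exists x', x' ∈ x /\ (x' = y \/ y ∈ x'))) as [[x' [Hx' K]]|N].
  { right. right. destruct K as [<- |K]; [exact Hx'|exact (ord_trans Hx Hx' K)]. }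
  destruct (classic (exists y', y' ∈ y /\ (x = y' \/ x ∈ y'))) as [[y' [Hy' K]]|N'].
  { left. destruct K as [-> |K]; [exact Hy'|exact (ord_trans Hy Hy' K)]. }
  right. left. apply set_ext. intros z. split; intros Hz.
  - destruct (IHx z Hz y Hy) as [K|K]; [exact K|]. destruct N. eauto.
  - destruct (IHy z Hz) as [K|[K|K]]; [destruct N'; eauto|destruct N'; eauto|exact K].
Qed.

Definition least (a : M) (P : M -> Prop) : M :=
  the (fun b => b ∈ a /\ P b /\ forall c, c ∈ b -> ~ P c).

Lemma T_least t (P : (nat -> M) -> M -> Prop) :
  T t -> D (fun e => P (fun k => e (S k)) (e 0)) -> T (fun e => least (t e) (P e)).
Proof. intros. unfold least. definability. Qed.
#[local] Hint Resolve T_least : definability.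

Lemma least_spec a (P : M -> Prop) : D1 P -> ord a -> (exists b, b ∈ a /\ P b) ->
  least a P ∈ a /\ P (least a P) /\ forall c, c ∈ least a P -> ~ P c.
Proof.
  intros HP Ha [b [Hb Pb]]. unfold least. apply the_spec.
  - destruct (ord_least HP (ord_elem Ha Hb) Pb) as [c [_ [Pc [Hcb Hc]]]].
    exists c. split; [|auto]. destruct Hcb as [K| ->]; [exact (ord_trans Ha Hb K)|exact Hb].
  - intros x y [Hx [Px Lx]] [Hy [Py Ly]].
    destruct (ord_trichotomy (ord_elem Ha Hx) (ord_elem Ha Hy)) as [K|[K|K]];
      [destruct (Ly x K Px)|exact K|destruct (Lx y K Py)].
Qed.

Lemma fin_max k s : ord k -> s ⊆ k -> fin s -> s <> empty ->
  exists m, m ∈ s /\ forall y, y ∈ s -> y ∈ m \/ y = m.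
Proof.
  intros Hk Hs Fs.
  apply (fin_ind (P := fun s => s <> empty -> exists m, m ∈ s /\ forall y, y ∈ s -> y ∈ m \/ y = m))
    with (a := s); [definability|tauto| |exact Fs].
  intros b x _ Hb Hx IH _.
  destruct (classic (b = empty)) as [->|N].
  - exists x. split; [apply in_add; auto|]. intros y Hy.
    apply in_add in Hy as [Hy| ->]; [destruct (in_empty Hy)|auto].
  - destruct (IH N) as [m [Hm Lm]].
    assert (Om : ord m) by (apply ord_elem with k; auto).
    assert (Ox : ord x) by (apply ord_elem with k; auto).
    destruct (ord_trichotomy Om Ox) as [K|[K|K]].
    + exists x. split; [apply in_add; auto|]. intros y Hy.
      apply in_add in Hy as [Hy| ->]; [|auto].
      left. destruct (Lm y Hy) as [K'| ->]; [exact (ord_trans Ox K K')|exact K].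
    + subst x. exists m. split; [apply in_add; auto|]. intros y Hy.
      apply in_add in Hy as [Hy| ->]; auto.
    + exists m. split; [apply in_add; auto|]. intros y Hy.
      apply in_add in Hy as [Hy| ->]; auto.
Qed.

Lemma ord_omega : ord omega.
Proof.
  assert (H : forall m, m ∈ omega -> transitive_set m /\ m ⊆ omega).
  { apply omega_ind; [definability| |].
    - split; intros z Hz; destruct (in_empty Hz).
    - intros m Hm [Tm Sm]. split.
      + intros y Hy z Hz. apply in_succ. left.
        apply in_succ in Hy as [Hy| ->]; [exact (Tm y Hy z Hz)|exact Hz].
      + intros z Hz. apply in_succ in Hz as [Hz| ->]; auto. }
  split; [intros m Hm|intros m Hm]; apply H, Hm.
Qed.

Lemma omega_sub m : m ∈ omega -> m ⊆ omega.
Proof. intros Hm. apply (proj1 ord_omega), Hm. Qed.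

Lemma omega_fin m : m ∈ omega -> fin m.
Proof.
  revert m. apply omega_ind; [definability|apply fin_empty|]. intros m _. apply fin_add.
Qed.

Lemma pigeonhole m : m ∈ omega -> ~ injects (succ m) m.
Proof.
  revert m. apply omega_ind; [definability| |].
  - intros [h [Hh _]]. apply (@in_empty (app h empty)), Hh, in_succ. auto.
  (* Cancelling the last point on both sides reduces the claim for [succ m] to the one for [m]. *)
  - intros m _ IH H. apply IH. exact (injects_swap (mem_irrefl (x := succ m)) H).
Qed.

Lemma omega_not_injects m : m ∈ omega -> ~ injects omega m.
Proof.
  intros Hm H. apply (pigeonhole Hm). refine (injects_trans _ H).
  apply injects_sub, omega_sub, omega_succ, Hm.
Qed.

Lemma fin_injects a : fin a -> exists m, m ∈ omega /\ injects a m.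
Proof.
  apply (fin_ind (P := fun a => exists m, m ∈ omega /\ injects a m)); [definability| |].
  - exists empty. split; [apply omega_0|apply injects_empty].
  - intros b x _ _ _ [m [Hm [h [Hh Ih]]]].
    destruct (classic (x ∈ b)) as [Hx|Hx].
    { rewrite (add_mem Hx). exists m. split; [exact Hm|]. exists h. auto. }
    exists (succ m). split; [apply omega_succ, Hm|].
    apply injects_intro with (fun y => cond (y = x) m (app h y)); [definability| |].
    + intros y Hy. apply in_succ. apply in_add in Hy as [Hy| ->].
      * rewrite cond_false; [auto|]. intros ->. tauto.
      * rewrite cond_true; auto.
    + assert (E : forall y, y ∈ b -> cond (y = x) m (app h y) = app h y).
      { intros y Hy. apply cond_false. intros ->. tauto. }
      assert (E' : cond (x = x) m (app h x) = m) by (apply cond_true; reflexivity).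
      intros y z Hy Hz. apply in_add in Hy as [Hy| ->]; apply in_add in Hz as [Hz| ->];
        rewrite ?E', ?E by assumption; intros K; auto.
      * exfalso. apply (@mem_irrefl m). rewrite <- K at 1. auto.
      * exfalso. apply (@mem_irrefl m). rewrite K at 1. auto.
Qed.

Lemma fin_not_omega a : fin a -> ~ injects omega a.
Proof.
  intros Ha H. destruct (fin_injects Ha) as [m [Hm K]].
  exact (omega_not_injects Hm (injects_trans H K)).
Qed.

(** A finite subset never exhausts [X], so it can be enlarged by a point. Each [m] only requires an
    existential statement, so no sequence is chosen. *)
Lemma infinite_large X m : ~ fin X -> m ∈ omega ->
  exists a, a ⊆ X /\ fin a /\ injects m a.
Proof.
  intros HX. revert m. apply omega_ind; [definability| |].
  - exists empty. split; [intros z Hz; destruct (in_empty Hz)|].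
    split; [apply fin_empty|apply injects_empty].
  - intros m Hm [a [Ha [Fa [h [Hh Ih]]]]].
    destruct (classic (X ⊆ a)) as [K|K]; [destruct (HX (fin_sub Fa K))|].
    apply not_all_ex_not in K as [x Hx]. apply imply_to_and in Hx as [Hx Nx].
    exists (add a x). split; [apply add_sub; assumption|]. split; [apply fin_add, Fa|].
    apply injects_intro with (fun y => cond (y = m) x (app h y)); [definability| |].
    + intros y Hy. apply in_add. apply in_succ in Hy as [Hy| ->].
      * rewrite cond_false; [auto|]. intros ->. exact (mem_irrefl Hy).
      * rewrite cond_true; auto.
    + assert (E : forall y, y ∈ m -> cond (y = m) x (app h y) = app h y).
      { intros y Hy. apply cond_false. intros ->. exact (mem_irrefl Hy). }
      assert (E' : cond (m = m) x (app h m) = x) by (apply cond_true; reflexivity).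
      intros y z Hy Hz. apply in_succ in Hy as [Hy| ->]; apply in_succ in Hz as [Hz| ->];
        rewrite ?E', ?E by assumption; intros K; auto;
        exfalso; apply Nx; [rewrite <- K|rewrite K]; auto.
Qed.


(** * Recursion on ordinals *)

Definition restrict (h g : M) : M :=
  sep h (fun p => exists u, u ∈ g /\ exists y, p = opair u y).

Lemma T_restrict t u : T t -> T u -> T (fun e => restrict (t e) (u e)).
Proof. intros. unfold restrict. definability. Qed.
#[local] Hint Resolve T_restrict : definability.


Definition recursion_graph (G : M -> M -> M) (d h : M) : Prop :=
  h = lam d (fun g => G g (restrict h g)).

(** The value at [g] is computed from the approximation with domain [g], named by description. This
    makes [rec] a definable total operation before any existence proof. *)
Definition rec (G : M -> M -> M) (g : M) : M := G g (the (recursion_graph G g)).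

Lemma T_rec (G : (nat -> M) -> M -> M -> M) t :
  T (fun e => G (fun k => e (S (S k))) (e 0) (e 1)) -> T t ->
  T (fun e => rec (G e) (t e)).
Proof.
  intros HG Ht. unfold rec, recursion_graph. apply (T_app2 (fun k => k) HG); definability.
Qed.

Lemma restrict_lam d g t : T1 t -> ord d -> g ∈ d -> restrict (lam d t) g = lam g t.
Proof.
  intros Ht Hd Hg. apply set_ext. intros z.
  unfold restrict. rewrite in_sep by definability. unfold lam. rewrite !in_img by definability. split.
  - intros [[x [Hx ->]] [u [Hu [y E]]]]. apply opair_inj in E as [-> _]. eauto.
  - intros [x [Hx ->]]. split; [|eauto]. exists x. split; [|reflexivity].
    exact (ord_trans Hd Hg Hx).
Qed.

(** Existence and uniqueness go through one induction: the recursion equation at [g] is available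
    only once the approximation on [g] is known to be unique. *)
Lemma rec_graph_unique (G : M -> M -> M) (HG : T2 G) d : ord d ->
  recursion_graph G d (lam d (rec G)) /\ forall h, recursion_graph G d h -> h = lam d (rec G).
Proof.
  assert (HG' : T (fun e => G (e 0) (e 1))) by exact HG.
  assert (HR : T1 (rec G)) by (apply (T_rec (G := fun _ => G)); [exact HG|definability]).
  apply (ord_ind (P := fun d =>
    recursion_graph G d (lam d (rec G)) /\ forall h, recursion_graph G d h -> h = lam d (rec G)));
    [unfold recursion_graph; definability|].
  intros b Hb IH.
  assert (Heq : forall g, g ∈ b -> rec G g = G g (lam g (rec G))).
  { intros g Hg. destruct (IH g Hg) as [I1 I2]. unfold rec at 1. f_equal.
    apply the_eq; assumption. }
  split.
  - unfold recursion_graph. apply lam_ext; [definability|unfold restrict; definability|].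
    intros g Hg. rewrite restrict_lam by assumption. auto.
  - intros h Hh.
    assert (Hr : forall g, g ∈ b -> restrict h g = lam g (fun g => G g (restrict h g))).
    { intros g Hg. transitivity (restrict (lam b (fun g => G g (restrict h g))) g);
        [f_equal; exact Hh|apply restrict_lam; [definability|assumption..]]. }
    (* The restriction of an approximation is again an approximation, so uniqueness below [b]
       identifies it. *)
    assert (Hg : forall g, g ∈ b -> restrict h g = lam g (rec G)).
    { intros g Hg. apply (IH g Hg). unfold recursion_graph.
      transitivity (lam g (fun g => G g (restrict h g))); [exact (Hr g Hg)|].
      apply lam_ext; [definability|definability|]. intros u Hu. f_equal.
      rewrite (Hr g Hg). rewrite restrict_lam; [|definability|exact (ord_elem Hb Hg)|exact Hu].
      apply Hr. exact (ord_trans Hb Hg Hu). }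
    transitivity (lam b (fun g => G g (restrict h g))); [exact Hh|].
    apply lam_ext; [definability|definability|]. intros g Hgb. rewrite (Hg g Hgb). symmetry. auto.
Qed.

Lemma rec_eq G g : T2 G -> ord g -> rec G g = G g (lam g (rec G)).
Proof.
  intros HG Hg. destruct (rec_graph_unique HG Hg) as [H1 H2].
  unfold rec at 1. f_equal. apply the_eq; assumption.
Qed.

(** Mostowski collapse of a set [X] of ordinals: [collapse X b] is the order type of
    [X ∩ b]. *)
Definition collapse (X b : M) : M :=
  rec (fun b h => img (sep b (fun g => g ∈ X)) (fun g => app h g)) b.

Lemma T_collapse t u : T t -> T u -> T (fun e => collapse (t e) (u e)).
Proof.
  intros Ht Hu. unfold collapse.
  apply (T_rec (G := fun e b h => img (sep b (fun g => g ∈ t e)) (fun g => app h g)));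
    definability.
Qed.
#[local] Hint Resolve T_collapse : definability.


Lemma in_collapse X b y : ord b ->
  (y ∈ collapse X b <-> exists g, g ∈ b /\ g ∈ X /\ y = collapse X g).
Proof.
  intros Hb. unfold collapse at 1. rewrite rec_eq; [|definability|exact Hb].
  rewrite in_img by definability. fold (collapse X).
  assert (HT : T1 (rec (fun b h => img (sep b (fun g => g ∈ X)) (fun g => app h g))))
    by (change (T1 (collapse X)); definability).
  split.
  - intros [g [Hg ->]]. apply in_sep in Hg as [Hg HX]; [|definability].
    rewrite app_lam by assumption. eauto.
  - intros [g [Hg [HX ->]]]. exists g.
    rewrite app_lam by assumption. split; [|reflexivity].
    apply in_sep; [definability|auto].
Qed.

Lemma collapse_ord X b : ord b -> ord (collapse X b).
Proof.
  apply (ord_ind (P := fun b => ord (collapse X b))); [definability|].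
  intros x Hx IH. split.
  - intros y Hy z Hz. apply in_collapse in Hy as [g [Hg [HX ->]]]; [|exact Hx].
    apply in_collapse in Hz as [g' [Hg' [HX' ->]]]; [|exact (ord_elem Hx Hg)].
    apply in_collapse; [exact Hx|]. exists g'. split; [exact (ord_trans Hx Hg Hg')|auto].
  - intros y Hy. apply in_collapse in Hy as [g [Hg [_ ->]]]; [|exact Hx].
    exact (proj1 (IH g Hg)).
Qed.

Lemma collapse_mem X b g : ord b -> g ∈ b -> g ∈ X -> collapse X g ∈ collapse X b.
Proof. intros Hb Hg HX. apply in_collapse; eauto. Qed.

Lemma collapse_inj X b g g' : ord b -> g ∈ b -> g' ∈ b -> g ∈ X -> g' ∈ X ->
  collapse X g = collapse X g' -> g = g'.
Proof.
  intros Hb Hg Hg' HX HX' E.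
  assert (O := ord_elem Hb Hg). assert (O' := ord_elem Hb Hg').
  destruct (ord_trichotomy O O') as [K|[K|K]]; [|exact K|]; exfalso;
    apply (@mem_irrefl (collapse X g)).
  - rewrite E at 2. apply collapse_mem; assumption.
  - rewrite E at 1. apply collapse_mem; assumption.
Qed.

(** Order types of subsets do not exceed the ordinal: if [x] were [collapse X g] with [g ∈ x], then
    [g ∈ collapse X g], against the induction hypothesis. *)
Lemma collapse_le X b : ord b -> b ∉ collapse X b.
Proof.
  apply (ord_ind (P := fun b => b ∉ collapse X b)); [definability|].
  intros x Hx IH H. apply in_collapse in H as [g [Hg [HX E]]]; [|exact Hx].
  apply (IH g Hg). rewrite <- E. exact Hg.
Qed.

(** * Translation of the notions of the statement *)

Lemma is_upair_iff (z x y : M) : is_upair z x y <-> z = upair x y.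
Proof.
  split.
  - intros H. apply set_ext. intros u. rewrite (H u), in_upair. reflexivity.
  - intros -> u. apply in_upair.
Qed.

Lemma is_pair_iff (p x y : M) : is_pair p x y <-> p = opair x y.
Proof.
  unfold is_pair. split.
  - intros H. apply set_ext. intros z. rewrite (H z), !is_upair_iff.
    unfold opair. rewrite in_upair. reflexivity.
  - intros -> z. rewrite !is_upair_iff. apply in_upair.
Qed.

Lemma maps_to_iff (f x y : M) : maps_to f x y <-> opair x y ∈ f.
Proof.
  split.
  - intros [p [Hp H]]. apply is_pair_iff in Hp. subst p. exact H.
  - intros H. exists (opair x y). split; [apply is_pair_iff; reflexivity|exact H].
Qed.

Lemma function_app (f x y : M) : is_function f -> maps_to f x y -> app f x = y.
Proof.
  intros [_ Hf] H. apply the_eq; [apply maps_to_iff, H|].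
  intros z Hz. apply maps_to_iff in Hz. eauto.
Qed.

Lemma lam_is_function X t : T1 t -> is_function (lam X t).
Proof.
  intros Ht. split.
  - intros p Hp. unfold lam in Hp. apply in_img in Hp as [x [_ ->]]; [|definability].
    exists x, (t x). apply is_pair_iff. reflexivity.
  - intros x y y' H H'. apply maps_to_iff, in_lam in H; [|exact Ht].
    apply maps_to_iff, in_lam in H'; [|exact Ht]. destruct H, H'. congruence.
Qed.

Lemma lam_is_dom X t : T1 t -> is_dom (lam X t) X.
Proof.
  intros Ht x. split.
  - intros Hx. exists (t x). apply maps_to_iff, in_lam; auto.
  - intros [y Hy]. apply maps_to_iff, in_lam in Hy; tauto.
Qed.

Lemma equinumerous_intro X Y t : T1 t -> (forall x, x ∈ X -> t x ∈ Y) ->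
  (forall x x', x ∈ X -> x' ∈ X -> t x = t x' -> x = x') ->
  (forall y, y ∈ Y -> exists x, x ∈ X /\ y = t x) -> equinumerous X Y.
Proof.
  intros Ht Hm Hi Hs.
  assert (H : forall x y, maps_to (lam X t) x y <-> x ∈ X /\ y = t x).
  { intros x y. rewrite maps_to_iff. apply in_lam, Ht. }
  exists (lam X t). split; [split; [|split]|].
  - apply lam_is_function, Ht.
  - apply lam_is_dom, Ht.
  - intros y. split.
    + intros Hy. destruct (Hs y Hy) as [x Hx]. exists x. apply H, Hx.
    + intros [x Hx]. apply H in Hx as [Hx ->]. auto.
  - intros x x' y Hx Hx'. apply H in Hx as [Hx ->]. apply H in Hx' as [Hx' E]. auto.
Qed.

Lemma equinumerous_injects (X Y : M) : equinumerous X Y -> injects X Y /\ injects Y X.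
Proof.
  intros [f [[Ff [Df Rf]] If]]. split.
  - exists f. split.
    + intros x Hx. destruct (proj1 (Df x) Hx) as [y Hy].
      rewrite (function_app Ff Hy). apply Rf. eauto.
    + intros x x' Hx Hx' E.
      destruct (proj1 (Df x) Hx) as [y Hy]. destruct (proj1 (Df x') Hx') as [y' Hy'].
      rewrite (function_app Ff Hy), (function_app Ff Hy') in E. subst y'.
      exact (If _ _ _ Hy Hy').
  - assert (H : forall y, y ∈ Y -> opair (the (fun x => opair x y ∈ f)) y ∈ f).
    { intros y Hy. apply (the_spec (P := fun x => opair x y ∈ f)).
      - destruct (proj1 (Rf y) Hy) as [x Hx]. exists x. apply maps_to_iff, Hx.
      - intros x x' Hx Hx'. apply maps_to_iff in Hx, Hx'. exact (If _ _ _ Hx Hx'). }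
    apply injects_intro with (fun y => the (fun x => opair x y ∈ f)); [definability| |].
    + intros y Hy. apply Df. exists y. apply maps_to_iff, H, Hy.
    + intros y y' Hy Hy' E. apply (proj2 Ff) with (the (fun x => opair x y ∈ f));
        apply maps_to_iff; [apply H, Hy|rewrite E; apply H, Hy'].
Qed.

(** The image in [omega] collapses onto an ordinal that is at most [omega]; a smaller one makes [X]
    finite, and [omega] itself makes it countably infinite. *)
Lemma countable_of_injects X : injects X omega -> countable X.
Proof.
  intros [h [Hh Ih]].
  set (S := img X (fun x => app h x)).
  assert (HS : forall y, y ∈ S <-> exists x, x ∈ X /\ y = app h x)
    by (intros y; apply in_img; definability).
  assert (E : equinumerous X (collapse S omega)).
  { apply equinumerous_intro with (fun x => collapse S (app h x)); [definability| | |].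
    - intros x Hx. apply collapse_mem; [exact ord_omega|auto|]. apply HS. eauto.
    - intros x x' Hx Hx' K. apply Ih; auto.
      apply collapse_inj with S omega; auto; try exact ord_omega; apply HS; eauto.
    - intros y Hy. apply in_collapse in Hy as [g [_ [Hg ->]]]; [|exact ord_omega].
      apply HS in Hg as [x [Hx ->]]. eauto. }
  destruct (ord_trichotomy (collapse_ord S ord_omega) ord_omega) as [K|[K|K]].
  - left. exists (collapse S omega). split; [|exact E].
    exists omega. split; [exact omega_spec|exact K].
  - right. exists omega. split; [exact omega_spec|]. rewrite K in E. exact E.
  - destruct (collapse_le ord_omega K).
Qed.

Lemma natural_omega (m : M) : is_natural m -> m ∈ omega.
Proof. intros [w [Hw H]]. rewrite (omega_unique omega_spec Hw). exact H. Qed.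

Lemma fin_is_finite a : fin a -> is_finite a.
Proof.
  intros Ha. destruct (fin_injects Ha) as [m [Hm K]].
  destruct (@countable_of_injects a) as [H|[w [Hw H]]].
  - exact (injects_trans K (injects_sub (omega_sub Hm))).
  - exact H.
  - rewrite (omega_unique Hw omega_spec) in H.
    destruct (fin_not_omega Ha (proj2 (equinumerous_injects H))).
Qed.

Lemma countably_infinite_injects (X : M) : countably_infinite X ->
  injects X omega /\ injects omega X.
Proof.
  intros [w [Hw H]]. rewrite (omega_unique Hw omega_spec) in H.
  exact (equinumerous_injects H).
Qed.


(** * The well-order of finite sets of ordinals *)

Definition Fin (X : M) : M := sep (power X) (fun a => fin a).

Lemma in_Fin X a : a ∈ Fin X <-> a ⊆ X /\ fin a.
Proof. unfold Fin. rewrite in_sep by definability. rewrite in_power. reflexivity. Qed.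

(** [lt t s] iff [t <> s] and the largest element of the symmetric difference
    lies in [s]; in particular [lt t s] for every finite
    [t ⊆ x ∪ {y ∈ s | x ∈ y}], [x ∈ s]. *)
Definition lt (t s : M) : Prop :=
  exists x, x ∈ s /\ forall y, y ∈ t -> y ∈ x \/ (y ∈ s /\ x ∈ y).

Definition lmin (S : M) : M := the (fun s => s ∈ S /\ forall t, t ∈ S -> ~ lt t s).

Lemma T_Fin t : T t -> T (fun e => Fin (t e)).
Proof. intros. unfold Fin. definability. Qed.
#[local] Hint Resolve T_Fin : definability.
Lemma D_lt t u : T t -> T u -> D (fun e => lt (t e) (u e)).
Proof. intros. unfold lt. definability. Qed.
#[local] Hint Resolve D_lt : definability.
Lemma T_lmin t : T t -> T (fun e => lmin (t e)).
Proof. intros. unfold lmin, lt. definability. Qed.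
#[local] Hint Resolve T_lmin : definability.


Lemma lt_irrefl s : ~ lt s s.
Proof.
  intros [x [Hx H]]. destruct (H x Hx) as [K|[_ K]]; exact (mem_irrefl K).
Qed.

Section Order.
Context (k : M) (Hk : ord k).

Lemma lt_trans r t s : r ∈ Fin k -> t ∈ Fin k -> s ∈ Fin k ->
  lt r t -> lt t s -> lt r s.
Proof.
  intros Hr Ht Hs [x [Hx Lx]] [z [Hz Lz]].
  apply in_Fin in Hr as [Hr _]. apply in_Fin in Ht as [Ht _]. apply in_Fin in Hs as [Hs _].
  assert (Oz : ord z) by exact (ord_elem Hk (Hs z Hz)).
  assert (Ox : ord x) by exact (ord_elem Hk (Ht x Hx)).
  destruct (Lz x Hx) as [K|[Hxs K]].
  - exists z. split; [exact Hz|]. intros y Hy. destruct (Lx y Hy) as [L|[L _]].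
    + left. exact (ord_trans Oz K L).
    + exact (Lz y L).
  - exists x. split; [exact Hxs|]. intros y Hy. destruct (Lx y Hy) as [L|[L L']].
    + auto.
    + right. destruct (Lz y L) as [N|[N _]]; [|auto].
      exfalso. exact (mem_asym K (ord_trans Oz N L')).
Qed.

Lemma lt_trichotomy t s : t ∈ Fin k -> s ∈ Fin k -> lt t s \/ t = s \/ lt s t.
Proof.
  intros Ht Hs.
  apply in_Fin in Ht as [Ht Ft]. apply in_Fin in Hs as [Hs Fs].
  set (d := sep (cup t s) (fun x => ~ (x ∈ t <-> x ∈ s))).
  assert (Hd : forall x, x ∈ d <-> x ∈ cup t s /\ ~ (x ∈ t <-> x ∈ s))
    by (intros x; apply in_sep; definability).
  destruct (classic (d = empty)) as [E|E].
  - right. left. apply set_ext. intros z. apply NNPP. intros N.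
    apply (@in_empty z). rewrite <- E. apply Hd. split; [|exact N].
    apply in_cup. tauto.
  - destruct (fin_max (s := d) Hk) as [m [Hm Lm]].
    + intros x Hx. apply Hd in Hx as [Hx _]. apply in_cup in Hx as [Hx|Hx]; auto.
    + apply fin_sub with (cup t s); [apply fin_cup; assumption|].
      intros x Hx. apply Hd in Hx. tauto.
    + exact E.
    + assert (Hmk : m ∈ k).
      { apply Hd in Hm as [Hm _]. apply in_cup in Hm as [Hm|Hm]; auto. }
      (* Above the largest point [m] of the symmetric difference the two sets agree, so [m]
         witnesses [lt] in favour of the set containing it. *)
      assert (Hgt : forall y, y ∈ k -> y ∈ m \/ y = m \/ (m ∈ y /\ (y ∈ t <-> y ∈ s))).
      { intros y Hy.
        destruct (ord_trichotomy (ord_elem Hk Hy) (ord_elem Hk Hmk)) as [K|[K|K]]; auto.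
        right. right. split; [exact K|]. apply NNPP. intros N.
        assert (Hyd : y ∈ d).
        { apply Hd. split; [|exact N]. apply in_cup. tauto. }
        destruct (Lm y Hyd) as [L|L]; [exact (mem_asym K L)|].
        subst y. exact (mem_irrefl K). }
      apply Hd in Hm as [Hm N]. apply in_cup in Hm.
      destruct (classic (m ∈ s)) as [Ms|Ms].
      * left. exists m. split; [exact Ms|]. intros y Hy.
        destruct (Hgt y (Ht y Hy)) as [K|[->|[K L]]]; tauto.
      * right. right. exists m. split; [tauto|]. intros y Hy.
        destruct (Hgt y (Hs y Hy)) as [K|[->|[K L]]]; tauto.
Qed.

(** Well-foundedness, by induction on an ordinal [a] above which all members of
    the family agree: minimise the largest element below [a], which then
    becomes part of the common top. *)
Lemma lt_minimal_aux a : ord a -> forall u S, S ⊆ Fin k -> (exists s, s ∈ S) ->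
  (forall s, s ∈ S -> forall y, (y ∈ s /\ y ∉ a) <-> y ∈ u) ->
  exists s, s ∈ S /\ forall t, t ∈ S -> ~ lt t s.
Proof.
  apply (ord_ind (P := fun a => forall u S, S ⊆ Fin k -> (exists s, s ∈ S) ->
    (forall s, s ∈ S -> forall y, (y ∈ s /\ y ∉ a) <-> y ∈ u) ->
    exists s, s ∈ S /\ forall t, t ∈ S -> ~ lt t s)); [definability|].
  clear a. intros a Ha IH u S HS [s0 Hs0] Hu.
  (* All members agree outside [a], so a witness of [lt] outside [a] would lie in both sets and
     hence in itself. *)
  assert (Habove : forall s t x, s ∈ S -> t ∈ S -> x ∈ s -> x ∉ a ->
    ~ forall y, y ∈ t -> y ∈ x \/ (y ∈ s /\ x ∈ y)).
  { intros s t x Hs Ht Hx Nx L.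
    assert (Hxt : x ∈ t) by (apply (Hu t Ht), (Hu s Hs); auto).
    destruct (L x Hxt) as [K|[_ K]]; exact (mem_irrefl K). }
  destruct (classic (exists s, s ∈ S /\ forall y, y ∈ s -> y ∉ a)) as [[s [Hs Ns]]|N].
  { exists s. split; [exact Hs|]. intros t Ht [x [Hx L]].
    exact (Habove s t x Hs Ht Hx (Ns x Hx) L). }
  (* For [b ∈ a] this says that [b] is the largest element of [s] below [a]. *)
  set (top := fun s b => b ∈ s /\ forall y, y ∈ s -> y ∈ a -> y ∈ b \/ y = b).
  assert (Htop : forall s, s ∈ S -> exists b, b ∈ a /\ top s b).
  { intros s Hs.
    set (c := sep s (fun y => y ∈ a)).
    assert (Hc : forall y, y ∈ c <-> y ∈ s /\ y ∈ a)
      by (intros y; unfold c; rewrite in_sep by definability; reflexivity).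
    destruct (proj1 (in_Fin _ _) (HS s Hs)) as [Hsk Fs].
    destruct (fin_max (s := c) Hk) as [m [Hm Lm]].
    - intros y Hy. apply Hc in Hy. apply Hsk. tauto.
    - apply fin_sub with s; [exact Fs|]. intros y Hy. apply Hc in Hy. tauto.
    - intros E. apply N. exists s. split; [exact Hs|]. intros y Hy Hya.
      apply (@in_empty y). rewrite <- E. apply Hc. auto.
    - apply Hc in Hm as [Hm Hma]. exists m. split; [exact Hma|]. split; [exact Hm|].
      intros y Hy Hya. apply Lm, Hc. auto. }
  destruct (Htop s0 Hs0) as [b0 [Hb0 Tb0]].
  destruct (ord_least (P := fun b => b ∈ a /\ exists s, s ∈ S /\ top s b) (a := b0))
    as [b [Ob [[Hb [s1 [Hs1 Tb1]]] [_ Lb]]]];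
    [unfold top; definability|exact (ord_elem Ha Hb0)|eauto|].
  set (S' := sep S (fun s => top s b)).
  assert (HS' : forall s, s ∈ S' <-> s ∈ S /\ top s b)
    by (intros s; unfold S'; rewrite in_sep by (unfold top; definability); reflexivity).
  (* [b] is the least of these largest elements. The members of [S'] attain it and agree outside
     [b], with common part [add u b]. *)
  destruct (IH b Hb (add u b) S') as [s [Hs Ms]].
  - intros s Hs. apply HS' in Hs. apply HS. tauto.
  - exists s1. apply HS'. auto.
  - intros s Hs y. apply HS' in Hs as [Hs [Hbs Ts]]. rewrite in_add. split.
    + intros [Hy Ny]. destruct (classic (y ∈ a)) as [Hya|Hya].
      * destruct (Ts y Hy Hya) as [K|K]; [tauto|auto].
      * left. apply (Hu s Hs). auto.
    + intros [Hy| ->]; [|split; [exact Hbs|apply mem_irrefl]].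
      apply (Hu s Hs) in Hy as [Hy Hya]. split; [exact Hy|].
      intros K. exact (Hya (ord_trans Ha Hb K)).
  - apply HS' in Hs as [Hs [Hbs Ts]]. exists s. split; [exact Hs|].
    intros t Ht [x [Hx L]].
    destruct (Htop t Ht) as [g [Hg [Hgt Tg]]].
    assert (Og := ord_elem Ha Hg).
    (* [g] is the largest element of [t] below [a]. A smaller [g] contradicts the choice of [b],
       [g = b] puts [t] into [S'], and a larger [g] is too large for a set that precedes [s]. *)
    destruct (ord_trichotomy Og Ob) as [K|[K|K]].
    + apply (Lb g K). split; [exact Hg|]. exists t. split; [exact Ht|]. split; assumption.
    + subst g. apply (Ms t); [apply HS'; split; [exact Ht|split; assumption]|].
      exists x. auto.
    + destruct (L g Hgt) as [Hgx|[Hgs _]].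
      * destruct (classic (x ∈ a)) as [Hxa|Hxa].
        -- destruct (Ts x Hx Hxa) as [Hxb| ->].
           ++ exact (mem_asym K (ord_trans Ob Hxb Hgx)).
           ++ exact (mem_asym K Hgx).
        -- exact (Habove s t x Hs Ht Hx Hxa L).
      * destruct (Ts g Hgs Hg) as [Hgb| ->]; [exact (mem_asym K Hgb)|exact (mem_irrefl K)].
Qed.

Lemma lmin_spec S : S ⊆ Fin k -> (exists s, s ∈ S) ->
  lmin S ∈ S /\ forall t, t ∈ S -> ~ lt t (lmin S).
Proof.
  intros HS HN. unfold lmin.
  apply (the_spec (P := fun s => s ∈ S /\ forall t, t ∈ S -> ~ lt t s)).
  (* The induction starts at the ordinal [k]: members are subsets of [k], so their common part
     outside [k] is empty. *)
  - apply (lt_minimal_aux Hk (u := empty) HS HN). intros s Hs y. split.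
    + intros [Hy N]. destruct N. apply HS, in_Fin in Hs. apply Hs, Hy.
    + intros Hy. destruct (in_empty Hy).
  - intros s t [Hs Ls] [Ht Lt].
    destruct (lt_trichotomy (HS s Hs) (HS t Ht)) as [K|[K|K]];
      [destruct (Lt s Hs K)|exact K|destruct (Ls t Ht K)].
Qed.

End Order.

(** * Countability of the finite subsets of [omega], and pairing *)

Definition seg (a : M) : M := sep (Fin omega) (fun b => lt b a).

Lemma in_seg a b : b ∈ seg a <-> b ∈ Fin omega /\ lt b a.
Proof. unfold seg. rewrite in_sep by definability. reflexivity. Qed.

Lemma fin_bounded a : a ∈ Fin omega -> exists m, m ∈ omega /\ a ⊆ m.
Proof.
  intros Ha. apply in_Fin in Ha as [Ha Fa].
  destruct (classic (a = empty)) as [->|N].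
  - exists empty. split; [apply omega_0|apply sub_refl].
  - destruct (fin_max ord_omega Ha Fa N) as [m [Hm Lm]]. exists (succ m).
    split; [apply omega_succ, Ha, Hm|]. intros y Hy. apply in_succ, Lm, Hy.
Qed.

(** If [a ⊆ m], all sets preceding [a] are subsets of [m] as well, and [power m] is finite. *)
Lemma fin_seg a : a ∈ Fin omega -> fin (seg a).
Proof.
  intros Ha. destruct (fin_bounded Ha) as [m [Hm Hma]].
  apply fin_sub with (power m); [apply fin_power, omega_fin, Hm|].
  intros b Hb. apply in_seg in Hb as [_ [x [Hx L]]]. apply in_power. intros y Hy.
  destruct (L y Hy) as [K|[K _]]; [|auto].
  exact (ord_trans (ord_elem ord_omega Hm) (Hma x Hx) K).
Qed.

(** A finite set is sent to the size of its initial segment, the least number into which the segment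
    injects. If [a] precedes [b], the segment of [b] contains that of [a] and also [a] itself, so
    equal sizes could be lowered by cancelling a point. *)
Lemma Fin_omega_injects : injects (Fin omega) omega.
Proof.
  set (P := fun a m => injects (seg a) m).
  assert (HP : forall a, D1 (P a)) by (intros a; unfold P, seg; definability).
  assert (H : forall a, a ∈ Fin omega -> least omega (P a) ∈ omega /\
     P a (least omega (P a)) /\ forall c, c ∈ least omega (P a) -> ~ P a c).
  { intros a Ha. apply least_spec; [apply HP|exact ord_omega|].
    apply fin_injects, fin_seg, Ha. }
  assert (Hlt : forall a b, a ∈ Fin omega -> b ∈ Fin omega -> lt a b ->
    least omega (P a) <> least omega (P b)).
  { intros a b Ha Hb L E. destruct (H a Ha) as [_ [_ La]].
    destruct (H b Hb) as [Mb [Ib _]]. rewrite E in La.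
    assert (Hab : a ∈ seg b) by (apply in_seg; auto).
    destruct (omega_cases Mb) as [E0|[m [Hm Em]]].
    - unfold P in Ib at 1. rewrite E0 in Ib. destruct Ib as [h [Hh _]].
      exact (in_empty (Hh a Hab)).
    - rewrite Em in La, Ib. apply (La m); [apply in_succ; auto|].
      apply injects_swap with (x := a) (y := m).
      + intros K. apply in_seg in K as [_ K]. exact (lt_irrefl K).
      + refine (injects_trans _ Ib). apply injects_sub. apply add_sub; [|exact Hab].
        intros c Hc. apply in_seg in Hc as [Hc Lc]. apply in_seg.
        split; [exact Hc|]. exact (lt_trans ord_omega Hc Ha Hb Lc L). }
  apply injects_intro with (fun a => least omega (P a)); [unfold P, seg; definability| |].
  - intros a Ha. apply H, Ha.
  - intros a b Ha Hb E. destruct (lt_trichotomy ord_omega Ha Hb) as [K|[K|K]].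
    + destruct (Hlt a b Ha Hb K E).
    + exact K.
    + destruct (Hlt b a Hb Ha K (eq_sym E)).
Qed.

Lemma img_inj X t a b : T1 t ->
  (forall x x', x ∈ X -> x' ∈ X -> t x = t x' -> x = x') ->
  a ⊆ X -> b ⊆ X -> img a t = img b t -> a = b.
Proof.
  intros Ht Hi.
  assert (Hs : forall a b, a ⊆ X -> b ⊆ X -> img a t = img b t -> a ⊆ b).
  { clear a b. intros a b Ha Hb E x Hx.
    assert (K : t x ∈ img b t) by (rewrite <- E; apply in_img; eauto).
    apply in_img in K as [y [Hy K]]; [|exact Ht].
    apply Hi in K; [subst; exact Hy|auto..]. }
  intros Ha Hb E. apply set_ext. intros z. split; apply Hs; auto.
Qed.

Lemma Fin_injects X : injects X omega -> injects (Fin X) omega.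
Proof.
  intros [h [Hh Ih]]. apply injects_trans with (Fin omega); [|exact Fin_omega_injects].
  apply injects_intro with (fun a => img a (fun x => app h x)); [definability| |].
  - intros a Ha. apply in_Fin in Ha as [Ha Fa]. apply in_Fin. split.
    + intros y Hy. apply in_img in Hy as [x [Hx ->]]; [auto|definability].
    + apply fin_img; [definability|exact Fa].
  - intros a b Ha Hb E. apply in_Fin in Ha as [Ha _]. apply in_Fin in Hb as [Hb _].
    revert E. apply img_inj with X; [definability|exact Ih|exact Ha|exact Hb].
Qed.

(** The Kuratowski pair is coded in two layers by the injection of [Fin omega] into [omega]. *)
Lemma omega_pairing : exists pr, T2 pr /\
  (forall i j, i ∈ omega -> j ∈ omega -> pr i j ∈ omega) /\
  (forall i j i' j', i ∈ omega -> j ∈ omega -> i' ∈ omega -> j' ∈ omega ->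
     pr i j = pr i' j' -> i = i' /\ j = j').
Proof.
  destruct Fin_omega_injects as [h [Hh Ih]].
  assert (Hu : forall i j, i ∈ omega -> j ∈ omega -> upair i j ∈ Fin omega).
  { intros i j Hi Hj. apply in_Fin. split.
    - intros z Hz. apply in_upair in Hz as [-> | ->]; assumption.
    - apply fin_sub with (add (add empty i) j); [apply fin_add, fin_add, fin_empty|].
      intros z Hz. rewrite !in_add. apply in_upair in Hz. tauto. }
  exists (fun i j => app h (upair (app h (upair i i)) (app h (upair i j)))).
  split; [definability|]. split; [auto|].
  intros i j i' j' Hi Hj Hi' Hj' E.
  apply opair_inj. unfold opair.
  assert (A : forall i j, i ∈ omega -> j ∈ omega -> app h (upair i j) ∈ omega) by auto.
  apply Ih in E; [|auto..].
  apply upair_inj in E as [[E1 E2]|[E1 E2]];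
    (apply Ih in E1; [|auto..]); (apply Ih in E2; [|auto..]); rewrite E1, E2;
    [reflexivity|].
  apply set_ext. intros z. rewrite !in_upair. tauto.
Qed.


(** * Countable sets of ordinals under [UD(ω₁)] *)

Section Main.
Context (k : M) (Hk : ord k).
Context (w1 f : M) (Hw : is_omega1 w1) (Hf : uniform_denumeration f w1).

(** Nonemptiness of [a] yields the condition that one is at most [a], by trichotomy. *)
Lemma denumeration_spec a : a ∈ w1 -> a <> empty ->
  (forall y, y ∈ a -> exists m, m ∈ omega /\ opair m y ∈ app f a) /\
  (forall m y y', opair m y ∈ app f a -> opair m y' ∈ app f a -> y = y').
Proof.
  intros Ha Na. destruct Hf as [Ff [_ H]].
  assert (Oa : ord a).
  { apply ord_elem with w1; [apply ordinal_ord, Hw|exact Ha]. }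
  destruct (H omega (succ empty) a omega_spec) as [g [Hg [Fg [Dg Rg]]]].
  - intros z. rewrite in_succ. split.
    + intros [K| ->]; [destruct (in_empty K)|]. intros u. apply in_empty.
    + intros K. right. apply sub_empty. intros u Hu. destruct (K u Hu).
  - exact Ha.
  - destruct (@ord_trichotomy (succ empty) a) as [K|[K|K]];
      [apply ord_elem with omega; [exact ord_omega|apply omega_succ, omega_0]
      |exact Oa|left; exact K|right; exact K|].
    destruct Na. apply in_succ in K as [K|K]; [destruct (in_empty K)|exact K].
  - rewrite (function_app Ff Hg). split.
    + intros y Hy. destruct (proj1 (Rg y) Hy) as [m Hm]. exists m. split.
      * apply Dg. eauto.
      * apply maps_to_iff, Hm.
    + intros m y y' Hy Hy'. apply (proj2 Fg) with m; apply maps_to_iff; assumption.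
Qed.

(** The order type of [X] injects into [omega] by inverting the collapse. Were it not below [w1], it
    would include [w1], which would then be countable. *)
Lemma collapse_in_omega1 X : X ⊆ k -> injects X omega -> collapse X k ∈ w1.
Proof.
  intros HX HI. destruct Hw as [Ow [Nw _]]. apply ordinal_ord in Ow.
  assert (K : injects (collapse X k) omega).
  { apply injects_trans with X; [|exact HI].
    set (P := fun y x => x ∈ X /\ collapse X x = y).
    assert (H : forall y, y ∈ collapse X k -> P y (the (P y))).
    { intros y Hy. apply the_spec.
      - apply in_collapse in Hy as [g [_ [Hg ->]]]; [|exact Hk]. exists g. split; auto.
      - intros x x' [Hx E] [Hx' E']. apply collapse_inj with X k; auto. congruence. }
    apply injects_intro with (fun y => the (P y)); [unfold P; definability| |].
    - intros y Hy. apply H, Hy.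
    - intros y y' Hy Hy' E. rewrite <- (proj2 (H y Hy)), <- (proj2 (H y' Hy')), E.
      reflexivity. }
  destruct (ord_trichotomy (collapse_ord X Hk) Ow) as [L|L]; [exact L|].
  destruct Nw. apply countable_of_injects. refine (injects_trans _ K).
  apply injects_sub. destruct L as [<- |L]; [apply sub_refl|].
  intros z Hz. exact (ord_trans (collapse_ord X Hk) L Hz).
Qed.

(** Without choice, [UD(ω₁)] is what makes this injection of a countable [X ⊆ k]
    into [ω] uniform in [X]. *)
Definition code (X x : M) : M :=
  least omega (fun m => opair m (collapse X x) ∈ app f (collapse X k)).

Lemma T_code t u : T t -> T u -> T (fun e => code (t e) (u e)).
Proof. intros. unfold code. definability. Qed.
#[local] Hint Resolve T_code : definability.

Lemma code_spec X : X ⊆ k -> injects X omega ->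
  (forall x, x ∈ X -> code X x ∈ omega) /\
  (forall x x', x ∈ X -> x' ∈ X -> code X x = code X x' -> x = x').
Proof.
  intros HX HI.
  assert (Hc : forall x, x ∈ X -> collapse X x ∈ collapse X k) by (intros; apply collapse_mem; auto).
  assert (H : forall x, x ∈ X -> code X x ∈ omega /\
    opair (code X x) (collapse X x) ∈ app f (collapse X k)).
  { intros x Hx. unfold code.
    destruct (least_spec (a := omega) (P := fun m => opair m (collapse X x) ∈ app f (collapse X k)))
      as [K1 [K2 _]]; [definability|exact ord_omega| |auto].
    apply denumeration_spec; [apply collapse_in_omega1; assumption| |auto].
    intros E. apply (@in_empty (collapse X x)). rewrite <- E. auto. }
  split; [apply H|].
  intros x x' Hx Hx' E.
  apply collapse_inj with X k; auto.
  destruct (H x Hx) as [_ K]. destruct (H x' Hx') as [_ K']. rewrite E in K.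
  revert K K'. apply denumeration_spec; [apply collapse_in_omega1; assumption|].
  intros E'. apply (@in_empty (collapse X x)). rewrite <- E'. auto.
Qed.


(** * Countable unions *)

Lemma injects_cup X Y : injects X omega -> injects Y omega -> injects (cup X Y) omega.
Proof.
  intros [g [Hg Ig]] [h [Hh Ih]]. destruct omega_pairing as [pr [Tpr [Hpr Ipr]]].
  assert (H0 := omega_0). assert (H1 := omega_succ omega_0).
  assert (N : empty <> succ empty).
  { intros E. apply (@in_empty empty). rewrite E at 2. apply in_succ. auto. }
  (* The two parts are tagged by 0 and 1; common points are treated as points of [X]. *)
  apply injects_intro with
    (fun z => cond (z ∈ X) (pr empty (app g z)) (pr (succ empty) (app h z))); [definability| |].
  - intros z Hz. apply in_cup in Hz. destruct (classic (z ∈ X)) as [K|K].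
    + rewrite cond_true by exact K. auto.
    + rewrite cond_false by exact K. apply Hpr; [exact H1|apply Hh; tauto].
  - intros z z' Hz Hz'. apply in_cup in Hz, Hz'.
    destruct (classic (z ∈ X)) as [K|K];
      [rewrite (cond_true _ _ K)|rewrite (cond_false _ _ K)];
    (destruct (classic (z' ∈ X)) as [K'|K'];
      [rewrite (cond_true _ _ K')|rewrite (cond_false _ _ K')]);
    intros E.
    + apply Ipr in E as [_ E]; auto.
    + apply Ipr in E as [E _]; auto; [tauto|]. apply Hh; tauto.
    + apply Ipr in E as [E _]; auto; [|apply Hh; tauto]. symmetry in E. tauto.
    + apply Ipr in E as [_ E]; auto; [apply Ih; tauto|apply Hh; tauto|apply Hh; tauto].
Qed.

(** A point goes to the pair formed by the least number of a piece containing it and its code in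
    that piece. Since the pieces are sets of ordinals, [code] enumerates all of them simultaneously,
    where choice would ordinarily be called for. *)
Lemma injects_bigcup I t : T1 t -> injects I omega ->
  (forall i, i ∈ I -> t i ⊆ k /\ injects (t i) omega) ->
  injects (bigcup I t) omega.
Proof.
  intros Ht [g [Hg Ig]] HI. destruct omega_pairing as [pr [Tpr [Hpr Ipr]]].
  set (P := fun x m => exists i, i ∈ I /\ x ∈ t i /\ app g i = m).
  set (first := fun x => least omega (P x)).
  set (Q := fun m i => i ∈ I /\ app g i = m).
  set (idx := fun m => the (Q m)).
  assert (HP : forall x, D1 (P x)) by (intros x; unfold P; definability).
  assert (H : forall x, x ∈ bigcup I t ->
    first x ∈ omega /\ idx (first x) ∈ I /\ x ∈ t (idx (first x))).
  { intros x Hx. apply in_bigcup in Hx as [i0 [Hi0 Hx]]; [|exact Ht].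
    destruct (least_spec (P := P x) (HP x) ord_omega) as [K1 [[i [Hi [Hxi Ei]]] _]].
    { exists (app g i0). split; [auto|]. exists i0. auto. }
    fold (first x) in K1, Ei. split; [exact K1|].
    replace (idx (first x)) with i; [auto|].
    symmetry. apply the_eq; [split; assumption|].
    intros j [Hj Ej]. apply Ig; auto. congruence. }
  apply injects_intro with (fun x => pr (first x) (code (t (idx (first x))) x));
    [unfold idx, first, Q, P; definability| |].
  - intros x Hx. destruct (H x Hx) as [K1 [K2 K3]]. apply Hpr; [exact K1|].
    apply code_spec; [apply HI, K2|apply HI, K2|exact K3].
  - intros x x' Hx Hx' E.
    destruct (H x Hx) as [K1 [K2 K3]]. destruct (H x' Hx') as [K1' [K2' K3']].
    destruct (HI _ K2) as [S1 S2]. destruct (HI _ K2') as [S1' S2'].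
    apply Ipr in E as [E E']; [|exact K1|apply code_spec; assumption|exact K1'
      |apply code_spec; assumption].
    rewrite <- E in *. revert E'. apply code_spec; assumption.
Qed.

(** * Closed sets *)

Context (F : M).

(** What matters about an [n]-almost disjoint family is only that every infinite
    set has a finite subset contained in at most one member. *)
Definition det (a : M) : Prop :=
  forall A B, A ∈ F -> B ∈ F -> a ⊆ A -> a ⊆ B -> A = B.

Context (HF : forall A, A ∈ F -> A ⊆ k /\ injects A omega /\ injects omega A).
Context (Hdet : forall X, ~ fin X -> exists a, a ⊆ X /\ fin a /\ det a).

Lemma D_det t : T t -> D (fun e => det (t e)).
Proof. intros. unfold det. definability. Qed.
#[local] Hint Resolve D_det : definability.

Definition closed (C : M) : Prop :=
  forall A, A ∈ F -> forall a, fin a -> det a -> a ⊆ A -> a ⊆ C -> A ⊆ C.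

(** The intersection of all closed supersets, taken inside [k] in order to be a set. *)
Definition cl (s : M) : M := sep k (fun x => forall C, closed C -> s ⊆ C -> x ∈ C).


Lemma D_closed t : T t -> D (fun e => closed (t e)).
Proof. intros. unfold closed. definability. Qed.
#[local] Hint Resolve D_closed : definability.
Lemma T_cl t : T t -> T (fun e => cl (t e)).
Proof. intros. unfold cl, closed. definability. Qed.
#[local] Hint Resolve T_cl : definability.


Lemma in_cl s x : x ∈ cl s <-> x ∈ k /\ forall C, closed C -> s ⊆ C -> x ∈ C.
Proof. unfold cl. rewrite in_sep by definability. reflexivity. Qed.

Lemma cl_sub s : cl s ⊆ k.
Proof. intros x Hx. apply in_cl in Hx. tauto. Qed.

Lemma cl_ext s : s ⊆ k -> s ⊆ cl s.
Proof. intros Hs x Hx. apply in_cl. auto. Qed.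

Lemma cl_min s C : closed C -> s ⊆ C -> cl s ⊆ C.
Proof. intros HC Hs x Hx. apply in_cl in Hx. apply Hx; assumption. Qed.

Lemma cl_closed s : closed (cl s).
Proof.
  intros A HA a Fa Da HaA Has x Hx. apply in_cl. split; [apply (HF HA), Hx|].
  intros C HC Hs. apply (HC A HA a Fa Da HaA); [|exact Hx].
  intros y Hy. exact (cl_min HC Hs (Has y Hy)).
Qed.

Lemma cl_mono s t : t ⊆ k -> s ⊆ t -> cl s ⊆ cl t.
Proof.
  intros Ht Hst. apply cl_min; [apply cl_closed|].
  exact (sub_trans Hst (cl_ext Ht)).
Qed.

Definition clfin (U : M) : M := bigcup (Fin U) (fun t => cl t).

Lemma in_clfin U x : x ∈ clfin U <-> exists t, t ∈ Fin U /\ x ∈ cl t.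
Proof. apply in_bigcup. definability. Qed.

(** The union defining [clfin U] is directed: two closures lie in the closure of the union of their
    finite generators. *)
Lemma clfin_fin U a : U ⊆ k -> fin a -> a ⊆ clfin U ->
  exists t, t ∈ Fin U /\ a ⊆ cl t.
Proof.
  intros HU Fa.
  apply (fin_ind (P := fun a => a ⊆ clfin U -> exists t, t ∈ Fin U /\ a ⊆ cl t))
    with (a := a); [unfold clfin; definability| | |exact Fa].
  - intros _. exists empty. split.
    + apply in_Fin. split; [|apply fin_empty]. intros z Hz. destruct (in_empty Hz).
    + intros z Hz. destruct (in_empty Hz).
  - intros b x _ _ _ IH H.
    destruct IH as [t [Ht Hb]]; [intros y Hy; apply H, in_add; auto|].
    destruct (proj1 (in_clfin U x)) as [t' [Ht' Hx]]; [apply H, in_add; auto|].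
    apply in_Fin in Ht as [Ht Ft]. apply in_Fin in Ht' as [Ht' Ft'].
    assert (K : cup t t' ⊆ U).
    { intros y Hy. apply in_cup in Hy as [Hy|Hy]; auto. }
    exists (cup t t'). split; [apply in_Fin; split; [exact K|apply fin_cup; assumption]|].
    assert (K' := sub_trans K HU).
    apply add_sub.
    + apply (sub_trans Hb), cl_mono; [exact K'|]. intros y Hy. apply in_cup. auto.
    + revert x Hx H. intros x Hx _. revert x Hx.
      apply cl_mono; [exact K'|]. intros y Hy. apply in_cup. auto.
Qed.

Lemma in_inter A B z : z ∈ sep A (fun z => z ∈ B) <-> z ∈ A /\ z ∈ B.
Proof. rewrite in_sep by definability. reflexivity. Qed.

(** An infinite intersection contains a finite determining set. By directedness that set lies in a
    single [cl t], which then contains all of [A]. *)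
Lemma fin_inter_clfin U A : U ⊆ k -> A ∈ F -> (forall t, t ∈ Fin U -> ~ A ⊆ cl t) ->
  fin (sep A (fun z => z ∈ clfin U)).
Proof.
  intros HU HA H. apply NNPP. intros N.
  destruct (Hdet N) as [a [Ha [Fa Da]]].
  assert (HaA : a ⊆ A) by (intros z Hz; apply Ha, in_inter in Hz; tauto).
  destruct (@clfin_fin U a HU Fa) as [t [Ht Hat]].
  { intros z Hz. apply Ha, in_inter in Hz. tauto. }
  exact (H t Ht (cl_closed HA Fa Da HaA Hat)).
Qed.

Definition below (s : M) : M := bigcup (sep (Fin k) (fun t => lt t s)) (fun t => cl t).

Lemma in_below s x : x ∈ below s <-> exists t, t ∈ Fin k /\ lt t s /\ x ∈ cl t.
Proof.
  unfold below. rewrite in_bigcup by definability. split.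
  - intros [t [Ht Hx]]. apply in_sep in Ht as [Ht L]; [eauto|definability].
  - intros [t [Ht [L Hx]]]. exists t. split; [apply in_sep; [definability|auto]|exact Hx].
Qed.

(** [below s] is the union of the finitely many sets [clfin (x ∪ {y ∈ s | x ∈ y})],
    [x ∈ s]. *)
Lemma fin_inter_below s A : s ∈ Fin k -> A ∈ F ->
  (forall t, t ∈ Fin k -> lt t s -> ~ A ⊆ cl t) -> fin (sep A (fun z => z ∈ below s)).
Proof.
  intros Hs HA H. apply in_Fin in Hs as [Hs Fs].
  (* [U x] consists of the points permitted to a set that [x] witnesses to precede [s]. *)
  set (U := fun x => cup x (sep s (fun y => x ∈ y))).
  assert (HU : forall x y, y ∈ U x <-> y ∈ x \/ (y ∈ s /\ x ∈ y)).
  { intros x y. unfold U. rewrite in_cup, in_sep by definability. reflexivity. }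
  assert (HUk : forall x, x ∈ s -> U x ⊆ k).
  { intros x Hx y Hy. apply HU in Hy as [Hy|[Hy _]]; [|auto].
    exact (ord_trans Hk (Hs x Hx) Hy). }
  assert (TU : T1 U) by (unfold U; definability).
  apply fin_sub with (bigcup s (fun x => sep A (fun z => z ∈ clfin (U x)))).
  - apply fin_bigcup; [unfold clfin; definability|exact Fs|].
    intros x Hx. apply fin_inter_clfin; [auto|exact HA|].
    intros t Ht. apply in_Fin in Ht as [Ht Ft]. apply H.
    + apply in_Fin. split; [exact (sub_trans Ht (HUk x Hx))|exact Ft].
    + exists x. split; [exact Hx|]. intros y Hy. apply HU, Ht, Hy.
  - intros z Hz. apply in_inter in Hz as [Hz Hb].
    apply in_below in Hb as [t [Ht [[x [Hx L]] Hzt]]].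
    apply in_bigcup; [unfold clfin; definability|]. exists x. split; [exact Hx|].
    apply in_inter. split; [exact Hz|]. apply in_clfin. exists t. split; [|exact Hzt].
    apply in_Fin in Ht as [_ Ft]. apply in_Fin. split; [|exact Ft].
    intros y Hy. apply HU, L, Hy.
Qed.


(** * Countability of closures *)

(** The unique member of [F] containing [a] if [a] is determining and such a member exists, and the
    empty set otherwise. *)
Definition span (a : M) : M := Union (sep F (fun A => det a /\ a ⊆ A)).
Definition spans (C : M) : M := bigcup (Fin C) (fun a => span a).
(** Builds the closure from below. Each stage collects [s] and the spans of all earlier stages, so
    successor and limit steps need no distinction. *)
Definition stage (s m : M) : M :=
  rec (fun m h => cup s (bigcup m (fun j => spans (app h j)))) m.

Lemma T_span t : T t -> T (fun e => span (t e)).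
Proof. intros. unfold span. definability. Qed.
#[local] Hint Resolve T_span : definability.
Lemma T_spans t : T t -> T (fun e => spans (t e)).
Proof. intros. unfold spans. definability. Qed.
#[local] Hint Resolve T_spans : definability.
Lemma T_stage t u : T t -> T u -> T (fun e => stage (t e) (u e)).
Proof.
  intros Ht Hu. unfold stage.
  apply (T_rec (G := fun e m h => cup (t e) (bigcup m (fun j => spans (app h j)))));
    definability.
Qed.
#[local] Hint Resolve T_stage : definability.

Lemma in_span a x : x ∈ span a <-> det a /\ exists A, A ∈ F /\ a ⊆ A /\ x ∈ A.
Proof.
  unfold span. rewrite in_Union. split.
  - intros [A [HA Hx]]. apply in_sep in HA as [HA [Da Ha]]; [|definability]. eauto.
  - intros [Da [A [HA [Ha Hx]]]]. exists A. split; [apply in_sep; [definability|auto]|exact Hx].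
Qed.

Lemma in_spans C x : x ∈ spans C <-> exists a, a ∈ Fin C /\ x ∈ span a.
Proof. apply in_bigcup. definability. Qed.

Lemma in_stage s m x : ord m ->
  (x ∈ stage s m <-> x ∈ s \/ exists j, j ∈ m /\ x ∈ spans (stage s j)).
Proof.
  intros Hm. unfold stage at 1. rewrite rec_eq; [|definability|exact Hm].
  fold (stage s). rewrite in_cup.
  assert (HT : T1 (rec (fun m h => cup s (bigcup m (fun j => spans (app h j))))))
    by (change (T1 (stage s)); definability).
  rewrite in_bigcup by definability.
  split; (intros [H|[j [Hj Hx]]]; [auto|right; exists j]);
    rewrite app_lam in * by assumption; auto.
Qed.

(** There are countably many finite subsets of [C], and each spans at most one member, which is
    countable. *)
Lemma spans_countable C : C ⊆ k -> injects C omega ->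
  spans C ⊆ k /\ injects (spans C) omega.
Proof.
  intros HC HI.
  assert (Hs : forall a, span a ⊆ k /\ injects (span a) omega).
  { intros a. split.
    - intros x Hx. apply in_span in Hx as [_ [A [HA [_ Hx]]]]. apply (HF HA), Hx.
    - destruct (classic (exists x, x ∈ span a)) as [[x Hx]|N].
      + apply in_span in Hx as [Da [A [HA [Ha _]]]].
        apply injects_trans with A; [|apply (HF HA)]. apply injects_sub.
        intros y Hy. apply in_span in Hy as [_ [B [HB [Hb Hy]]]].
        rewrite (Da A B); assumption.
      + apply injects_sub. intros x Hx. destruct N. eauto. }
  split.
  - intros x Hx. apply in_spans in Hx as [a [_ Hx]]. apply (Hs a), Hx.
  - apply injects_bigcup; [definability|apply Fin_injects, HI|]. intros a _. apply Hs.
Qed.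

Lemma stage_countable s m : s ⊆ k -> injects s omega -> ord m -> injects m omega ->
  stage s m ⊆ k /\ injects (stage s m) omega.
Proof.
  intros Hs HI.
  apply (ord_ind (P := fun m => injects m omega ->
    stage s m ⊆ k /\ injects (stage s m) omega)); [definability|].
  clear m. intros m Hm IH Im.
  assert (Hj : forall j, j ∈ m ->
    spans (stage s j) ⊆ k /\ injects (spans (stage s j)) omega).
  { intros j Hj. destruct (IH j Hj) as [S I].
    - apply injects_trans with m; [|exact Im]. apply injects_sub.
      intros z Hz. exact (ord_trans Hm Hj Hz).
    - apply spans_countable; assumption. }
  split.
  - intros x Hx. apply in_stage in Hx as [Hx|[j [Hj' Hx]]]; [auto| |exact Hm].
    apply (Hj j Hj'), Hx.
  - apply injects_trans with (cup s (bigcup m (fun j => spans (stage s j)))).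
    + apply injects_sub. intros x Hx. apply in_cup. rewrite in_bigcup by definability.
      apply in_stage; assumption.
    + apply injects_cup; [exact HI|]. apply injects_bigcup; [definability|exact Im|exact Hj].
Qed.

Lemma stage_mono s i j : ord i -> ord j -> i ⊆ j -> stage s i ⊆ stage s j.
Proof.
  intros Hi Hj Hij x Hx. apply in_stage; [exact Hj|].
  apply in_stage in Hx as [Hx|[l [Hl Hx]]]; [auto| |exact Hi]. right. eauto.
Qed.

(** The stages increase, so a finite subset of stage [omega] lies in some stage [j] with
    [j ∈ omega]. The member it determines is part of the spans of that stage, hence of stage
    [omega]. *)
Lemma stage_omega_closed s : closed (stage s omega).
Proof.
  intros A HA a Fa Da HaA Has.
  assert (Ho : forall m, m ∈ omega -> ord m) by (intros; apply ord_elem with omega;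
    [exact ord_omega|assumption]).
  assert (H : a ⊆ stage s omega -> exists j, j ∈ omega /\ a ⊆ stage s j).
  { apply (fin_ind (P := fun a => a ⊆ stage s omega -> exists j, j ∈ omega /\ a ⊆ stage s j));
      [definability| | |exact Fa].
    - intros _. exists empty. split; [apply omega_0|]. intros z Hz. destruct (in_empty Hz).
    - intros b x _ _ _ IH H.
      destruct IH as [i [Hi Hb]]; [intros y Hy; apply H, in_add; auto|].
      assert (Hx : x ∈ stage s omega) by (apply H, in_add; auto).
      assert (Hx' : exists j, j ∈ omega /\ x ∈ stage s j).
      { apply in_stage in Hx as [Hx|[j [Hj Hx]]]; [| |exact ord_omega].
        - exists empty. split; [apply omega_0|]. apply in_stage; [apply Ho, omega_0|auto].
        - exists (succ j). split; [apply omega_succ, Hj|].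
          apply in_stage; [apply ord_succ, Ho, Hj|]. right. exists j.
          split; [apply in_succ; auto|exact Hx]. }
      destruct Hx' as [j [Hj Hx']].
      destruct (ord_trichotomy (Ho i Hi) (Ho j Hj)) as [K|K].
      + exists j. split; [exact Hj|]. apply add_sub; [|exact Hx'].
        apply (sub_trans Hb), stage_mono; [auto..|]. exact (proj1 (Ho j Hj) i K).
      + exists i. split; [exact Hi|]. apply add_sub; [exact Hb|].
        refine (stage_mono (Ho j Hj) (Ho i Hi) _ Hx').
        destruct K as [<- |K]; [apply sub_refl|exact (proj1 (Ho i Hi) j K)]. }
  destruct (H Has) as [j [Hj Ha]].
  intros x Hx. apply in_stage; [exact ord_omega|]. right. exists j. split; [exact Hj|].
  apply in_spans. exists a. split; [apply in_Fin; auto|].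
  apply in_span. eauto.
Qed.

Lemma cl_countable s : s ∈ Fin k -> injects (cl s) omega.
Proof.
  intros Hs. apply in_Fin in Hs as [Hs Fs].
  apply injects_trans with (stage s omega).
  - apply injects_sub, cl_min; [apply stage_omega_closed|].
    intros x Hx. apply in_stage; [exact ord_omega|auto].
  - apply stage_countable; [exact Hs| |exact ord_omega|apply injects_sub, sub_refl].
    destruct (fin_injects Fs) as [m [Hm K]].
    exact (injects_trans K (injects_sub (omega_sub Hm))).
Qed.

(** * The disjointing function *)

Definition rank (A : M) : M := lmin (sep (Fin k) (fun s => A ⊆ cl s)).

(** The coding depends on [A] only through its rank, so members of equal rank are indexed by one
    common injection. *)
Definition is_index (A b : M) : Prop :=
  exists a, fin a /\ det a /\ a ⊆ A /\ b = img a (fun x => code (cl (rank A)) x).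

Definition index (A : M) : M := lmin (sep (Fin omega) (fun b => is_index A b)).

Definition earlier (A : M) : M :=
  sep F (fun B => rank B = rank A /\ lt (index B) (index A)).

(** The first part catches the intersections with all members of smaller rank, the second those with
    members of the same rank and smaller index. *)
Definition remainder (A : M) : M :=
  cup (sep A (fun z => z ∈ below (rank A)))
      (bigcup (earlier A) (fun B => sep A (fun z => z ∈ B))).

Lemma T_rank t : T t -> T (fun e => rank (t e)).
Proof. intros. unfold rank. definability. Qed.
#[local] Hint Resolve T_rank : definability.
Lemma T_index t : T t -> T (fun e => index (t e)).
Proof. intros. unfold index, is_index. definability. Qed.
#[local] Hint Resolve T_index : definability.

Lemma fin_det_subset A : A ∈ F -> exists a, fin a /\ det a /\ a ⊆ A.
Proof.
  intros HA. destruct (@Hdet A) as [a [Ha [Fa Da]]]; [|eauto].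
  intros N. exact (fin_not_omega N (proj2 (proj2 (HF HA)))).
Qed.

Lemma rank_spec A : A ∈ F -> rank A ∈ Fin k /\ A ⊆ cl (rank A) /\
  forall t, t ∈ Fin k -> lt t (rank A) -> ~ A ⊆ cl t.
Proof.
  intros HA.
  assert (Hin : forall s, s ∈ sep (Fin k) (fun s => A ⊆ cl s) <-> s ∈ Fin k /\ A ⊆ cl s)
    by (intros s; rewrite in_sep by definability; reflexivity).
  destruct (lmin_spec Hk (S := sep (Fin k) (fun s => A ⊆ cl s))) as [H L].
  - intros s Hs. apply Hin in Hs. tauto.
  (* The family to be minimised is nonempty: the closure of a determining finite subset of [A]
     contains [A]. *)
  - destruct (fin_det_subset HA) as [a [Fa [Da Ha]]].
    assert (Hak : a ⊆ k) by exact (sub_trans Ha (proj1 (HF HA))).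
    exists a. apply Hin. split; [apply in_Fin; auto|].
    exact (cl_closed HA Fa Da Ha (cl_ext Hak)).
  - fold (rank A) in H, L. apply Hin in H as [H1 H2]. split; [exact H1|].
    split; [exact H2|]. intros t Ht Lt K. apply (L t); [apply Hin; auto|exact Lt].
Qed.

Lemma code_rank A : A ∈ F ->
  (forall x, x ∈ A -> code (cl (rank A)) x ∈ omega) /\
  (forall x y, x ∈ cl (rank A) -> y ∈ cl (rank A) ->
     code (cl (rank A)) x = code (cl (rank A)) y -> x = y).
Proof.
  intros HA. destruct (rank_spec HA) as [H1 [H2 _]].
  destruct (code_spec (cl_sub (s := rank A)) (cl_countable H1)) as [K1 K2]. auto.
Qed.

Lemma index_spec A : A ∈ F -> index A ∈ Fin omega /\ is_index A (index A).
Proof.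
  intros HA.
  assert (Hin : forall b, b ∈ sep (Fin omega) (fun b => is_index A b) <->
      b ∈ Fin omega /\ is_index A b)
    by (intros b; rewrite in_sep by (unfold is_index; definability); reflexivity).
  apply Hin. unfold index.
  apply (lmin_spec ord_omega).
  - intros b Hb. apply Hin in Hb. tauto.
  - destruct (fin_det_subset HA) as [a [Fa [Da Ha]]].
    exists (img a (fun x => code (cl (rank A)) x)). apply Hin. split.
    + apply in_Fin. split; [|apply fin_img; [definability|exact Fa]].
      intros y Hy. apply in_img in Hy as [x [Hx ->]]; [|definability].
      apply (code_rank HA), Ha, Hx.
    + exists a. auto.
Qed.

(** With equal ranks both indices are images under the same injection, so they stem from the same
    determining set, which lies in only one member. *)
Lemma index_inj A B : A ∈ F -> B ∈ F -> rank A = rank B -> index A = index B -> A = B.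
Proof.
  intros HA HB Er Ei.
  destruct (index_spec HA) as [_ [a [Fa [Da [Ha Ea]]]]].
  destruct (index_spec HB) as [_ [b [Fb [Db [Hb Eb]]]]].
  assert (E : a = b).
  { apply img_inj with (cl (rank A)) (fun x => code (cl (rank A)) x); [definability| | | |].
    - apply code_rank, HA.
    - exact (sub_trans Ha (proj1 (proj2 (rank_spec HA)))).
    - rewrite Er. exact (sub_trans Hb (proj1 (proj2 (rank_spec HB)))).
    - rewrite <- Ea, Ei, Eb, Er. reflexivity. }
  subst b. apply Da; assumption.
Qed.

Lemma in_earlier A B : B ∈ earlier A <-> B ∈ F /\ rank B = rank A /\ lt (index B) (index A).
Proof. unfold earlier. rewrite in_sep by definability. reflexivity. Qed.

Lemma fin_inter A B : A ∈ F -> B ∈ F -> A <> B -> fin (sep A (fun z => z ∈ B)).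
Proof.
  intros HA HB N. apply NNPP. intros K. destruct (Hdet K) as [a [Ha [_ Da]]].
  apply N, Da; auto; intros z Hz; apply Ha, in_inter in Hz; tauto.
Qed.

(** Minimality of the rank makes the first part finite. For the second, [index] maps the earlier
    members of equal rank injectively into a finite segment, and two distinct members meet in a
    finite set. *)
Lemma fin_remainder A : A ∈ F -> fin (remainder A).
Proof.
  intros HA. apply fin_cup.
  - destruct (rank_spec HA) as [H1 [_ H3]]. apply fin_inter_below; assumption.
  - apply fin_bigcup; [definability| |].
    + apply (fin_inj (t := index)); [definability| |].
      * intros B C HB HC E. apply in_earlier in HB as [HB [EB _]].
        apply in_earlier in HC as [HC [EC _]]. apply index_inj; auto. congruence.
      * apply fin_sub with (seg (index A)); [apply fin_seg, index_spec, HA|].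
        intros b Hb. apply in_img in Hb as [B [HB ->]]; [|definability].
        apply in_earlier in HB as [HB [_ L]]. apply in_seg.
        split; [apply index_spec, HB|exact L].
    + intros B HB. apply in_earlier in HB as [HB [_ L]].
      apply fin_inter; [exact HA|exact HB|]. intros <-. exact (lt_irrefl L).
Qed.

Lemma remainder_sub A : remainder A ⊆ A.
Proof.
  intros z Hz. apply in_cup in Hz as [Hz|Hz].
  - apply in_inter in Hz. tauto.
  - apply in_bigcup in Hz as [B [_ Hz]]; [|definability]. apply in_inter in Hz. tauto.
Qed.

(** Ordering members by rank and then by index, a common point is removed from the later one. *)
Lemma remainder_inter A B z : A ∈ F -> B ∈ F -> A <> B -> z ∈ A -> z ∈ B ->
  z ∈ remainder A \/ z ∈ remainder B.
Proof.
  assert (Hlt : forall A B, A ∈ F -> B ∈ F -> z ∈ A -> z ∈ B ->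
    lt (rank A) (rank B) -> z ∈ remainder B).
  { intros C E HC HE Hz Hz' L. apply in_cup. left. apply in_inter.
    split; [exact Hz'|]. apply in_below. exists (rank C).
    destruct (rank_spec HC) as [H1 [H2 _]]. auto. }
  assert (Hlt' : forall A B, A ∈ F -> B ∈ F -> z ∈ A -> z ∈ B -> rank A = rank B ->
    lt (index A) (index B) -> z ∈ remainder B).
  { intros C E HC HE Hz Hz' Er L. apply in_cup. right.
    apply in_bigcup; [definability|]. exists C. split; [apply in_earlier; auto|].
    apply in_inter. auto. }
  intros HA HB N Hz Hz'.
  destruct (lt_trichotomy Hk (proj1 (rank_spec HA)) (proj1 (rank_spec HB))) as [K|[K|K]].
  - right. exact (Hlt A B HA HB Hz Hz' K).
  - destruct (lt_trichotomy ord_omega (proj1 (index_spec HA)) (proj1 (index_spec HB)))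
      as [L|[L|L]].
    + right. exact (Hlt' A B HA HB Hz Hz' K L).
    + destruct N. apply index_inj; assumption.
    + left. exact (Hlt' B A HB HA Hz' Hz (eq_sym K) L).
  - left. exact (Hlt B A HB HA Hz' Hz K).
Qed.

Lemma essentially_disjoint_of_det : essentially_disjoint F.
Proof.
  assert (HT : T1 remainder) by (unfold remainder, earlier, below; definability).
  assert (Hmap : forall A s, maps_to (lam F remainder) A s -> s = remainder A).
  { intros A s H. apply maps_to_iff, in_lam in H; [tauto|exact HT]. }
  exists (lam F remainder). split; [apply lam_is_function, HT|].
  split; [apply lam_is_dom, HT|]. split.
  - intros A s HA Hs. rewrite (Hmap A s Hs).
    split; [apply remainder_sub|apply fin_is_finite, fin_remainder, HA].
  - intros A B s t C E HA HB N Hs Ht HC HE z [Hz Hz'].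
    rewrite (Hmap A s Hs) in HC. rewrite (Hmap B t Ht) in HE.
    apply HC in Hz as [Hz Nz]. apply HE in Hz' as [Hz' Nz'].
    destruct (remainder_inter HA HB N Hz Hz'); tauto.
Qed.

End Main.

(** * Determining sets in almost disjoint families *)

Lemma n_almost_disjoint_det F n : n ∈ omega -> n_almost_disjoint n F ->
  forall X, ~ fin X -> exists a, a ⊆ X /\ fin a /\ det F a.
Proof.
  (* A finite subset of [X] with at least [n] points is determining: two distinct members containing
     it would meet in a set of size [c ∈ n], against the pigeonhole principle. *)
  intros Hn Had X HX. destruct (infinite_large HX Hn) as [a [Ha [Fa Ia]]].
  exists a. split; [exact Ha|]. split; [exact Fa|].
  intros A B HA HB HaA HaB. apply NNPP. intros N.
  destruct (Had A B HA HB N) as [I [HI [c [_ [Hc Hcn]]]]].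
  apply equinumerous_injects in Hc as [Hc _].
  assert (Oc : c ∈ omega) by exact (omega_sub Hn Hcn).
  apply (pigeonhole Oc).
  apply injects_trans with n.
  - apply injects_sub, add_sub; [|exact Hcn].
    exact (proj1 (ord_elem ord_omega Hn) c Hcn).
  - apply (injects_trans Ia). refine (injects_trans _ Hc). apply injects_sub.
    intros z Hz. apply HI. auto.
Qed.

End ZF.

Theorem theorem4p4 (M : set_structure) (HZF : ZF M) (HUD : UD_omega1 M)
    (kappa : M) (Hkappa : is_cardinal kappa)
    (n : M) (Hn : is_natural n)
    (F : M) (HF : family_of_countably_infinite_subsets F kappa)
    (Had : n_almost_disjoint n F) :
  essentially_disjoint F.
Proof.
  destruct HUD as [w1 [f [Hw Hf]]].
  apply (@essentially_disjoint_of_det M HZF kappa (ordinal_ord (proj1 Hkappa)) w1 f Hw Hf F).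
  - intros A HA. destruct (HF A HA) as [HAk HAc]. split; [exact HAk|].
    exact (countably_infinite_injects HZF HAc).
  - exact (n_almost_disjoint_det (natural_omega HZF Hn) Had).
Qed.
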